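(* There is a unique morphism of $\mathcal{C}$-algebras $\Delta_u:\tilde{\mathcal{U}}_q'(\hat{\mathfrak{g}})\to\tilde{\mathcal{U}}_q'(\hat{\mathfrak{g}})\hat\otimes\tilde{\mathcal{U}}_q'(\hat{\mathfrak{g}})$ such that for all $i\in I$, $r\in\mathbb{Z}$, $m\ge0$, $h\in\mathfrak{h}$: $$\Delta_u(x_{i,r}^+)=x_{i,r}^+\otimes1+\sum_{l\ge0}u^{r+l}(\phi_{i,-l}^-\otimes x_{i,r+l}^+),$$ $$\Delta_u(x_{i,r}^-)=u^r(1\otimes x_{i,r}^-)+\sum_{l\ge0}u^l(x_{i,r-l}^-\otimes\phi_{i,l}^+),$$ $$\Delta_u(\phi_{i,\pm m}^{\pm})=\sum_{0\le l\le m}u^{\pm l}(\phi_{i,\pm(m-l)}^{\pm}\otimes\phi_{i,\pm l}^{\pm}),\qquad\Delta_u(k_h)=k_h\otimes k_h.$$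
   Context: $q\in\mathbb{C}^*$ is not a root of unity; a logarithm of $q$ is fixed so that $q^a$ makes sense for $a\in\mathbb{Q}$. $C=(C_{i,j})_{i,j\in I}$, $I=\{1,\dots,n\}$, is a generalized Cartan matrix: $C_{i,j}\in\mathbb{Z}$, $C_{i,i}=2$, $C_{i,j}\le 0$ for $i\neq j$, $C_{i,j}=0\Leftrightarrow C_{j,i}=0$. It is symmetrizable: positive integers $r_1,\dots,r_n$ are fixed such that $B=(B_{i,j})$, $B_{i,j}=r_iC_{i,j}$, is symmetric. $q_i=q^{r_i}$, $[m]_z=\frac{z^m-z^{-m}}{z-z^{-1}}$. A realization of $C$ is fixed: $\mathfrak{h}$ is a $\mathbb{Q}$-vector space of dimension $2n-\mathrm{rank}(C)$, with linearly independent families $\alpha_1,\dots,\alpha_n\in\mathfrak{h}^*$ and $\alpha_1^\vee,\dots,\alpha_n^\vee\in\mathfrak{h}$ satisfying $\alpha_j(\alpha_i^\vee)=C_{i,j}$. $\tilde{\mathcal{U}}_q(\hat{\mathfrak{g}})$ is the $\mathbb{C}$-algebra with generators $x_{i,r}^{\pm}$ ($i\in I,r\in\mathbb{Z}$), $k_h$ ($h\in\mathfrak{h}$), $h_{i,m}$ ($i\in I$, $m\in\mathbb{Z}\setminus\{0\}$) and relations (R1) $k_hk_{h'}=k_{h+h'}$, $k_0=1$, $[k_h,h_{j,m}]=0$, $[h_{i,m},h_{j,m'}]=0$; (R2) $k_hx_{j,r}^{\pm}k_{-h}=q^{\pm\alpha_j(h)}x_{j,r}^{\pm}$; (R3) $[h_{i,m},x_{j,r}^{\pm}]=\pm\frac1m[mB_{i,j}]_q\,x_{j,m+r}^{\pm}$;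 (R4) $[x_{i,r}^+,x_{j,r'}^-]=\delta_{i,j}\frac{\phi^+_{i,r+r'}-\phi^-_{i,r+r'}}{q_i-q_i^{-1}}$; (R5) $x_{i,r+1}^{\pm}x_{j,r'}^{\pm}-q^{\pm B_{i,j}}x_{j,r'}^{\pm}x_{i,r+1}^{\pm}=q^{\pm B_{i,j}}x_{i,r}^{\pm}x_{j,r'+1}^{\pm}-x_{j,r'+1}^{\pm}x_{i,r}^{\pm}$ (the affine quantum Serre relations are not imposed). Here $\phi_{i,m}^{\pm}$ is defined by $\sum_{m\ge0}\phi_{i,\pm m}^{\pm}z^{\pm m}=k_{\pm r_i\alpha_i^\vee}\exp\big(\pm(q-q^{-1})\sum_{m'\ge1}h_{i,\pm m'}z^{\pm m'}\big)$, with $\phi^+_{i,m}=0$ for $m<0$ and $\phi^-_{i,m}=0$ for $m>0$. $\mathcal{C}=\mathbb{C}((u))$ is the field of formal Laurent series, $\tilde{\mathcal{U}}_q'(\hat{\mathfrak{g}})=\mathcal{C}\otimes_{\mathbb{C}}\tilde{\mathcal{U}}_q(\hat{\mathfrak{g}})$, and $\tilde{\mathcal{U}}_q'(\hat{\mathfrak{g}})\hat\otimes\tilde{\mathcal{U}}_q'(\hat{\mathfrak{g}})=(\tilde{\mathcal{U}}_q(\hat{\mathfrak{g}})\otimes_{\mathbb{C}}\tilde{\mathcal{U}}_q(\hat{\mathfrak{g}}))((u))$, the $u$-adic completion of $\tilde{\mathcal{U}}_q'(\hat{\mathfrak{g}})\otimes_{\mathcal{C}}\tilde{\mathcal{U}}_q'(\hat{\mathfrak{g}})$,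 with its natural $\mathcal{C}$-algebra structure. *)

(* Defs.v *)
From HB Require Import structures.
From mathcomp Require Import all_boot all_order all_algebra.
From mathcomp Require Import boolp classical_sets fsbigop reals.
From mathcomp Require Import sequences exp trigo.
From mathcomp Require Import complex finmap monalg zify.

Set Implicit Arguments.
Unset Strict Implicit.
Unset Printing Implicit Defensive.

Import Order.TTheory GRing.Theory Num.Theory.

Local Open Scope ring_scope.
Local Open Scope quotient_scope.

(* A unital associative K-algebra, as a ring with a central ring morphism from
   K. Unlike algType this allows 1 = 0, so that arbitrary presentations give
   instances without a nontriviality proof. *)
HB.mixin Record PzRing_isPzAlgebra (K : pzRingType) A of GRing.PzRing A := {
  scal : K -> A;
  scalD : forall c d, scal (c + d) = scal c + scal d;
  scalM : forall c d, scal (c * d) = scal c * scal d;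
  scal1 : scal 1 = 1;
  scalC : forall c x, scal c * x = x * scal c
}.

#[short(type="pzAlgType")]
HB.structure Definition PzAlgebra (K : pzRingType) :=
  {A of PzRing_isPzAlgebra K A & GRing.PzRing A}.

Definition alg_morphism (K : pzRingType) (A B : pzAlgType K) (f : A -> B) :=
  [/\ {morph f : x y / x + y}, {morph f : x y / x * y} &
      forall c : K, f (scal c) = scal c].

Section Quotient.
Variables (K : pzRingType) (A : pzAlgType K) (E : A -> A -> Prop).

(* The least congruence of K-algebras containing E, i.e. congruence modulo
   the two-sided ideal generated by the differences a - b with E a b. *)
Inductive alg_cong : A -> A -> Prop :=
| alg_cong_rel a b : E a b -> alg_cong a b
| alg_cong_refl a : alg_cong a a
| alg_cong_sym a b : alg_cong a b -> alg_cong b a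
| alg_cong_trans a b c : alg_cong a b -> alg_cong b c -> alg_cong a c
| alg_congD a a' b b' :
    alg_cong a a' -> alg_cong b b' -> alg_cong (a + b) (a' + b')
| alg_congM a a' b b' :
    alg_cong a a' -> alg_cong b b' -> alg_cong (a * b) (a' * b').

Definition alg_congb (a b : A) : bool := `[< alg_cong a b >].

Lemma alg_congb_equiv : equiv_class_of alg_congb.
Proof.
split=> [a|a b|b a c]; first by apply/asboolP; exact: alg_cong_refl.
  by apply/asboolP/asboolP; exact: alg_cong_sym.
by move=> /asboolP ab /asboolP bc; apply/asboolP; exact: alg_cong_trans ab bc.
Qed.

Canonical alg_congb_equivRel := EquivRelPack alg_congb_equiv.
Canonical alg_congb_encModRel := defaultEncModRel alg_congb.

Definition alg_quot := {eq_quot alg_congb}.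

HB.instance Definition _ := Choice.on alg_quot.

Definition alg_pi (a : A) : alg_quot := \pi_alg_quot a.

Lemma alg_piP a b : alg_pi a = alg_pi b <-> alg_cong a b.
Proof.
split=> [/eqP|ab]; last by apply/eqP; rewrite eqmodE; apply/asboolP.
by rewrite eqmodE => /asboolP.
Qed.

Lemma alg_quotW (P : alg_quot -> Prop) :
  (forall a, P (alg_pi a)) -> forall x, P x.
Proof. by move=> Ppi x; rewrite -[x]reprK; exact: Ppi. Qed.

Lemma alg_cong_repr a : alg_cong (repr (alg_pi a)) a.
Proof. by apply/alg_piP; rewrite /alg_pi reprK. Qed.

Definition quot_add (x y : alg_quot) := alg_pi (repr x + repr y).
Definition quot_opp (x : alg_quot) := alg_pi (- repr x).
Definition quot_mul (x y : alg_quot) := alg_pi (repr x * repr y).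

Lemma quot_addE a b : quot_add (alg_pi a) (alg_pi b) = alg_pi (a + b).
Proof. by apply/alg_piP/alg_congD; exact: alg_cong_repr. Qed.

Lemma quot_oppE a : quot_opp (alg_pi a) = alg_pi (- a).
Proof.
apply/alg_piP; rewrite -(mulN1r (repr _)) -(mulN1r a).
by apply: alg_congM (alg_cong_repr _); exact: alg_cong_refl.
Qed.

Lemma quot_mulE a b : quot_mul (alg_pi a) (alg_pi b) = alg_pi (a * b).
Proof. by apply/alg_piP/alg_congM; exact: alg_cong_repr. Qed.

Let qE := (quot_addE, quot_oppE, quot_mulE).

Fact quot_addA : associative quot_add.
Proof.
elim/alg_quotW=> a; elim/alg_quotW=> b; elim/alg_quotW=> c.
by rewrite !qE addrA.
Qed.
Fact quot_addC : commutative quot_add.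
Proof. by elim/alg_quotW=> a; elim/alg_quotW=> b; rewrite !qE addrC. Qed.
Fact quot_add0 : left_id (alg_pi 0) quot_add.
Proof. by elim/alg_quotW=> a; rewrite !qE add0r. Qed.
Fact quot_addN : left_inverse (alg_pi 0) quot_opp quot_add.
Proof. by elim/alg_quotW=> a; rewrite !qE addNr. Qed.

HB.instance Definition _ :=
  GRing.isZmodule.Build alg_quot quot_addA quot_addC quot_add0 quot_addN.

Fact quot_mulA : associative quot_mul.
Proof.
elim/alg_quotW=> a; elim/alg_quotW=> b; elim/alg_quotW=> c.
by rewrite !qE mulrA.
Qed.
Fact quot_mul1 : left_id (alg_pi 1) quot_mul.
Proof. by elim/alg_quotW=> a; rewrite !qE mul1r. Qed.
Fact quot_mulr1 : right_id (alg_pi 1) quot_mul.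
Proof. by elim/alg_quotW=> a; rewrite !qE mulr1. Qed.
Fact quot_mulDl : left_distributive quot_mul quot_add.
Proof.
elim/alg_quotW=> a; elim/alg_quotW=> b; elim/alg_quotW=> c.
by rewrite !qE mulrDl.
Qed.
Fact quot_mulDr : right_distributive quot_mul quot_add.
Proof.
elim/alg_quotW=> a; elim/alg_quotW=> b; elim/alg_quotW=> c.
by rewrite !qE mulrDr.
Qed.

HB.instance Definition _ := GRing.Zmodule_isPzRing.Build alg_quot
  quot_mulA quot_mul1 quot_mulr1 quot_mulDl quot_mulDr.

Lemma alg_piD a b : alg_pi (a + b) = alg_pi a + alg_pi b.
Proof. by rewrite -quot_addE. Qed.
Lemma alg_piM a b : alg_pi (a * b) = alg_pi a * alg_pi b.
Proof. by rewrite -quot_mulE. Qed.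

Definition quot_scal (c : K) : alg_quot := alg_pi (scal c).

Fact quot_scalD c d : quot_scal (c + d) = quot_scal c + quot_scal d.
Proof. by rewrite /quot_scal scalD alg_piD. Qed.
Fact quot_scalM c d : quot_scal (c * d) = quot_scal c * quot_scal d.
Proof. by rewrite /quot_scal scalM alg_piM. Qed.
Fact quot_scal1 : quot_scal 1 = 1.
Proof. by rewrite /quot_scal scal1. Qed.
Fact quot_scalC c x : quot_scal c * x = x * quot_scal c.
Proof. by elim/alg_quotW: x => a; rewrite -!alg_piM scalC. Qed.

HB.instance Definition _ := PzRing_isPzAlgebra.Build K alg_quot
  quot_scalD quot_scalM quot_scal1 quot_scalC.

Lemma alg_pi_morphism : alg_morphism alg_pi.
Proof. by split=> // [a b|a b]; rewrite ?alg_piD ?alg_piM. Qed.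

End Quotient.

Section FreeAlgebra.
Variables (K : comNzRingType) (I : choiceType).

Definition free_alg := {malg K[{fmonom I}]}.

HB.instance Definition _ := GRing.Lalgebra.on free_alg.

Definition free_var (i : I) : free_alg := << fmu i >>.

Definition free_scal (c : K) : free_alg := c%:A.

Fact free_scalD c d : free_scal (c + d) = free_scal c + free_scal d.
Proof. exact: scalerDl. Qed.
Fact free_scalM c d : free_scal (c * d) = free_scal c * free_scal d.
Proof. by rewrite /free_scal -scalerAl mul1r scalerA. Qed.
Fact free_scal1 : free_scal 1 = 1.
Proof. exact: scale1r. Qed.
Fact free_scalE c : free_scal c = << c *g monalg.one >> :> {malg K[{fmonom I}]}.
Proof. by rewrite /free_scal -mul_malgC mulr1. Qed.
Fact free_scalC c (x : free_alg) : free_scal c * x = x * free_scal c.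
Proof.
rewrite free_scalE 2!malgM_def fgmulUg fgmulgU.
by apply: eq_bigr => k _; rewrite mul1m mulm1 mulrC.
Qed.

HB.instance Definition _ := PzRing_isPzAlgebra.Build K free_alg
  free_scalD free_scalM free_scal1 free_scalC.

Lemma free_alg_ind (P : free_alg -> Prop) :
  P 0 -> (forall x y, P x -> P y -> P (x + y)) ->
  (forall c (s : seq I), P (scal c * \prod_(i <- s) free_var i)) ->
  forall x, P x.
Proof.
move=> P0 PD Pw x; rewrite (monalgE x).
have {}Pw c (s : seq I) : P (c *: \prod_(i <- s) free_var i).
  by rewrite -[X in _ *: X]mul1r scalerAl; exact: Pw.
apply: (big_ind P) => // k _.
suff -> : << x@_k *g k >> = x@_k *: \prod_(i <- (k : seq I)) free_var i :> free_alg.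
  exact: Pw.
have -> : << x@_k *g k >> = x@_k *: << k >> :> free_alg.
  by rewrite -mul_malgC malgM_def fgmulUU mulr1 mul1m.
congr (_ *: _); case: k => s /=; elim: s => [|i s IHs].
  by rewrite big_nil -fmoneE.
rewrite big_cons -IHs malgM_def fgmulUU mulr1; congr (<< _ *g _ >>).
by rewrite /mmul /= fmmulE fmuE.
Qed.

End FreeAlgebra.

Section Tensor.
Variables (K : comNzRingType) (A B : pzAlgType K).

Local Notation F := (free_alg K (A * B)%type).
Local Notation v a b := (free_var K (a, b) : F).

(* The relations tens_1 and tens_M reduce words in the symbols (a, b) to single
   symbols: they cut F down to the monoid algebra of A * B, on which the other
   relations generate the usual submodule of bilinear relations. *)
Inductive tens_rel : F -> F -> Prop :=
| tens_1 : tens_rel (v 1 1) 1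
| tens_M a a' b b' : tens_rel (v a b * v a' b') (v (a * a') (b * b'))
| tens_Dl a a' b : tens_rel (v (a + a') b) (v a b + v a' b)
| tens_Dr a b b' : tens_rel (v a (b + b')) (v a b + v a b')
| tens_Zl c a b : tens_rel (v (scal c * a) b) (scal c * v a b)
| tens_Zr c a b : tens_rel (v a (scal c * b)) (scal c * v a b).

Definition tens := alg_quot tens_rel.

HB.instance Definition _ := PzAlgebra.on tens.

Definition pure_tens (a : A) (b : B) : tens := alg_pi tens_rel (v a b).

Local Notation "a ⊗ b" := (pure_tens a b) (at level 40).

Lemma pure_tens1 : 1 ⊗ 1 = 1.
Proof. exact/alg_piP/alg_cong_rel/tens_1. Qed.

Lemma pure_tensM a a' b b' : (a ⊗ b) * (a' ⊗ b') = (a * a') ⊗ (b * b').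
Proof. by rewrite -alg_piM; exact/alg_piP/alg_cong_rel/tens_M. Qed.

Lemma pure_tensDl a a' b : (a + a') ⊗ b = a ⊗ b + a' ⊗ b.
Proof. by rewrite -alg_piD; exact/alg_piP/alg_cong_rel/tens_Dl. Qed.

Lemma pure_tensDr a b b' : a ⊗ (b + b') = a ⊗ b + a ⊗ b'.
Proof. by rewrite -alg_piD; exact/alg_piP/alg_cong_rel/tens_Dr. Qed.

Lemma pure_tensZl c a b : (scal c * a) ⊗ b = scal c * (a ⊗ b).
Proof.
have -> : scal c = alg_pi tens_rel (scal c) :> tens by [].
rewrite -alg_piM.
exact/alg_piP/alg_cong_rel/tens_Zl.
Qed.

Lemma pure_tensZr c a b : a ⊗ (scal c * b) = scal c * (a ⊗ b).
Proof.
have -> : scal c = alg_pi tens_rel (scal c) :> tens by [].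
rewrite -alg_piM.
exact/alg_piP/alg_cong_rel/tens_Zr.
Qed.

Lemma pure_tens0l b : 0 ⊗ b = 0.
Proof. by apply: (addrI (0 ⊗ b)); rewrite -pure_tensDl !addr0. Qed.

Lemma pure_tens0r a : a ⊗ 0 = 0.
Proof. by apply: (addrI (a ⊗ 0)); rewrite -pure_tensDr !addr0. Qed.

Lemma tens_ind (P : tens -> Prop) :
  (forall a b, P (a ⊗ b)) -> (forall x y, P x -> P y -> P (x + y)) ->
  forall x, P x.
Proof.
move=> Ppure PD; have P0 : P 0 by rewrite -(pure_tens0l 0); exact: Ppure.
elim/alg_quotW; elim/free_alg_ind => [//|x y Px Py|c s].
  by rewrite alg_piD; exact: PD.
rewrite alg_piM; have -> : alg_pi tens_rel (scal c) = scal c by [].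
suff [a [b ->]] : exists a b,
    alg_pi tens_rel (\prod_(i <- s) free_var K i) = a ⊗ b.
  by rewrite -pure_tensZl.
elim: s => [|[a b] s [a' [b' IHs]]].
  by exists 1, 1; rewrite big_nil pure_tens1.
by exists (a * a'), (b * b'); rewrite big_cons alg_piM IHs -pure_tensM.
Qed.

End Tensor.

Notation "a ⊗ b" := (pure_tens a b) (at level 40, left associativity) : ring_scope.

Section Laurent.
Variable A : pzRingType.

Record laurent := Laurent {
  laurent_coef :> int -> A;
  laurent_bounded : exists N : int, forall n, n < N -> laurent_coef n = 0
}.

HB.instance Definition _ := gen_eqMixin laurent.
HB.instance Definition _ := gen_choiceMixin laurent.

Implicit Types f g h : laurent.

Lemma laurentP f g : f =1 g -> f = g.
Proof.
case: f g => [f bf] [g bg] /= /funext fg; case: _ / fg in bg *.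
by congr Laurent; exact: Prop_irrelevance.
Qed.

Fact laurent_add_bounded f g :
  exists N : int, forall n, n < N -> f n + g n = 0.
Proof.
have [[N fN] [M gM]] := (laurent_bounded f, laurent_bounded g).
exists (Num.min N M) => n; rewrite lt_min => /andP[nN nM].
by rewrite fN // gM // addr0.
Qed.
Definition laurent_add f g := Laurent (laurent_add_bounded f g).

Fact laurent_opp_bounded f : exists N : int, forall n, n < N -> - f n = 0.
Proof. by have [N fN] := laurent_bounded f; exists N => n /fN ->; rewrite oppr0. Qed.
Definition laurent_opp f := Laurent (laurent_opp_bounded f).

Fact laurent_mono_bounded (k : int) (a : A) :
  exists N : int, forall n, n < N -> (if n == k then a else 0) = 0.
Proof. by exists k => n /lt_eqF ->. Qed.
(* a u^k *)
Definition laurent_mono k a := Laurent (laurent_mono_bounded k a).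

Fact laurent_series_bounded (k : int) (F : nat -> A) :
  exists N : int, forall n, n < N -> (if k <= n then F `|n - k|%N else 0) = 0.
Proof. by exists k => n; rewrite ltNge => /negPf ->. Qed.
(* \sum_(l >= 0) F l u^(k + l) *)
Definition laurent_series k F := Laurent (laurent_series_bounded k F).

(* The family summed here has finite support. *)
Definition laurent_mul_coef f g (n : int) : A :=
  (\sum_(i \in [set: int]) (f i * g (n - i)))%R.

Lemma laurent_mul_coefE f g (N M n : int) (k : nat) :
  (forall i, i < N -> f i = 0) -> (forall i, i < M -> g i = 0) ->
  n - N - M < k%:Z ->
  laurent_mul_coef f g n = \sum_(i < k) f (N + i%:Z) * g (n - N - i%:Z).
Proof.
move=> fN gM nk; rewrite /laurent_mul_coef.
pose r := [seq N + i%:Z | i <- iota 0 k].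
rewrite (fsbigE r) //=.
- rewrite big_map -[k in iota 0 k]subn0 big_mkcond /= big_mkord.
  by apply: eq_bigr => i _; rewrite in_setT opprD addrA.
- by rewrite map_inj_uniq ?iota_uniq // => i j /addrI [].
- move=> i _ /= ir.
  have [iN|Ni] := ltP i N; first by rewrite fN // mul0r.
  rewrite [g _]gM ?mulr0 //.
  have ki : k%:Z <= i - N.
    rewrite leNgt; apply: contra ir => ik.
    by apply/mapP; exists `|i - N|%N; [rewrite mem_iota; lia | lia].
  lia.
Qed.

Fact laurent_mul_bounded f g :
  exists N : int, forall n, n < N -> laurent_mul_coef f g n = 0.
Proof.
have [[N fN] [M gM]] := (laurent_bounded f, laurent_bounded g).
exists (N + M) => n nNM.
by rewrite (laurent_mul_coefE (k := 0) fN gM) ?big_ord0 //; lia.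
Qed.
Definition laurent_mul f g := Laurent (laurent_mul_bounded f g).

Fact laurent_addA : associative laurent_add.
Proof. by move=> f g h; apply: laurentP => n /=; rewrite addrA. Qed.
Fact laurent_addC : commutative laurent_add.
Proof. by move=> f g; apply: laurentP => n /=; rewrite addrC. Qed.
Fact laurent_add0 : left_id (laurent_mono 0 0) laurent_add.
Proof. by move=> f; apply: laurentP => n /=; rewrite if_same add0r. Qed.
Fact laurent_addN : left_inverse (laurent_mono 0 0) laurent_opp laurent_add.
Proof. by move=> f; apply: laurentP => n /=; rewrite if_same addNr. Qed.

HB.instance Definition _ := GRing.isZmodule.Build laurent
  laurent_addA laurent_addC laurent_add0 laurent_addN.

Lemma laurent_coef0 n : (0 : laurent) n = 0.
Proof. by rewrite /= if_same. Qed.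
Lemma laurent_coefD f g n : (f + g) n = f n + g n.
Proof. by []. Qed.

Fact laurent_mulA : associative laurent_mul.
Proof.
move=> f g h; apply: laurentP => n /=.
have [N fN] := laurent_bounded f.
have [M gM] := laurent_bounded g.
have [P hP] := laurent_bounded h.
have fgNM i : i < N + M -> laurent_mul f g i = 0.
  by move=> iNM /=; rewrite (laurent_mul_coefE (k := 0) fN gM) ?big_ord0 //; lia.
have ghMP i : i < M + P -> laurent_mul g h i = 0.
  by move=> iMP /=; rewrite (laurent_mul_coefE (k := 0) gM hP) ?big_ord0 //; lia.
pose k := (absz (n - N - M - P)%R).+1.
have ghE (i : nat) : laurent_mul_coef g h (n - N - i%:Z) =
    \sum_(a < k) g (M - i%:Z + a%:Z) * h (n - N - i%:Z - (M - i%:Z) - a%:Z).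
  by apply: laurent_mul_coefE => [j ji||]; [apply: gM; lia | exact: hP | lia].
have fgE (a : nat) : (a < k)%N -> laurent_mul_coef f g (N + M + a%:Z) =
    \sum_(i < k) f (N + i%:Z) * g (N + M + a%:Z - N - i%:Z).
  by move=> ak; apply: laurent_mul_coefE fN gM _; lia.
rewrite (laurent_mul_coefE (k := k) fN ghMP); last by lia.
rewrite (laurent_mul_coefE (k := k) fgNM hP); last by lia.
under eq_bigr => i _ do rewrite /= ghE mulr_sumr.
rewrite exchange_big /=; apply: eq_bigr => a _.
rewrite fgE // mulr_suml; apply: eq_bigr => i _; rewrite mulrA.
by congr (_ * _ * _); congr (laurent_coef _ _); lia.
Qed.

Fact laurent_mono_mulE k a f n :
  laurent_mul_coef (laurent_mono k a) f n = a * f (n - k).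
Proof.
have [M fM] := laurent_bounded f.
rewrite (@laurent_mul_coefE _ _ k M _ (absz (n - k - M)%R).+1 _ fM) /=; last by lia.
  rewrite big_ord_recl /= addr0 eqxx subr0 big1 ?addr0 // => i _.
  by rewrite /bump /= ifF ?mul0r //; lia.
by move=> i ik; rewrite ifF //; lia.
Qed.

Fact laurent_mul1 : left_id (laurent_mono 0 1) laurent_mul.
Proof.
by move=> f; apply: laurentP => n; rewrite /= laurent_mono_mulE mul1r subr0.
Qed.

Fact laurent_mulr_mono0 f a n :
  laurent_mul_coef f (laurent_mono 0 a) n = f n * a.
Proof.
have [N fN] := laurent_bounded f.
have [nN|Nn] := ltP n N.
  rewrite (@laurent_mul_coefE _ _ N 0 _ 0 fN) ?big_ord0 ?fN ?mul0r //=.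
    by move=> i i0; rewrite ifF //; lia.
  by lia.
rewrite (@laurent_mul_coefE _ _ N 0 _ (absz (n - N)%R).+1 fN) /=; last by lia.
  rewrite big_ord_recr /= big1 ?add0r => [|i _].
    by rewrite ifT; [congr (laurent_coef _ _ * _); lia | lia].
  by rewrite ifF ?mulr0 //; case: i => /=; lia.
by move=> i i0; rewrite ifF //; lia.
Qed.

Fact laurent_mulr1 : right_id (laurent_mono 0 1) laurent_mul.
Proof.
by move=> f; apply: laurentP => n; rewrite /= laurent_mulr_mono0 mulr1.
Qed.

Fact laurent_mulDl : left_distributive laurent_mul +%R.
Proof.
move=> f g h; apply: laurentP => n; rewrite [RHS]laurent_coefD /=.
have [N fN] := laurent_bounded f.
have [M gM] := laurent_bounded g.
have [P hP] := laurent_bounded h.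
pose L := Num.min N M; pose k := (absz (n - L - P)%R).+1.
have fL i : i < L -> f i = 0 by move=> iL; apply: fN; lia.
have gL i : i < L -> g i = 0 by move=> iL; apply: gM; lia.
have fgL i : i < L -> (f + g) i = 0.
  by move=> iL; rewrite laurent_coefD fL // gL // addr0.
rewrite (@laurent_mul_coefE _ _ L P _ k fgL hP); last by lia.
rewrite (@laurent_mul_coefE _ _ L P _ k fL hP); last by lia.
rewrite (@laurent_mul_coefE _ _ L P _ k gL hP); last by lia.
by rewrite -big_split; apply: eq_bigr => i _; rewrite laurent_coefD mulrDl.
Qed.

Fact laurent_mulDr : right_distributive laurent_mul +%R.
Proof.
move=> f g h; apply: laurentP => n; rewrite [RHS]laurent_coefD /=.
have [N fN] := laurent_bounded f.
have [M gM] := laurent_bounded g.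
have [P hP] := laurent_bounded h.
pose L := Num.min M P; pose k := (absz (n - N - L)%R).+1.
have gL i : i < L -> g i = 0 by move=> iL; apply: gM; lia.
have hL i : i < L -> h i = 0 by move=> iL; apply: hP; lia.
have ghL i : i < L -> (g + h) i = 0.
  by move=> iL; rewrite laurent_coefD gL // hL // addr0.
rewrite (@laurent_mul_coefE _ _ N L _ k fN ghL); last by lia.
rewrite (@laurent_mul_coefE _ _ N L _ k fN gL); last by lia.
rewrite (@laurent_mul_coefE _ _ N L _ k fN hL); last by lia.
by rewrite -big_split; apply: eq_bigr => i _; rewrite laurent_coefD mulrDr.
Qed.

HB.instance Definition _ := GRing.Zmodule_isPzRing.Build laurent
  laurent_mulA laurent_mul1 laurent_mulr1 laurent_mulDl laurent_mulDr.

Lemma laurent_monoM j k a b :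
  laurent_mono j a * laurent_mono k b = laurent_mono (j + k) (a * b).
Proof.
apply: laurentP => n; rewrite /= laurent_mono_mulE /=.
by rewrite subr_eq [k + j]addrC; case: ifP => _; rewrite ?mulr0.
Qed.

Lemma laurent_monoD k a b :
  laurent_mono k (a + b) = laurent_mono k a + laurent_mono k b.
Proof. by apply: laurentP => n /=; case: ifP; rewrite ?addr0. Qed.

Lemma laurent_comm f g : (forall i j, f i * g j = g j * f i) -> f * g = g * f.
Proof.
move=> fg; apply: laurentP => n.
have nK : involutive (fun i : int => n - i) by move=> i; lia.
rewrite -[RHS]/(laurent_mul_coef g f n) /laurent_mul_coef.
rewrite [RHS](reindex_fsbigT _ _ (inv_bij nK)) /=.
by apply: eq_fsbigr => i _; rewrite nK -fg.
Qed.

End Laurent.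

Section LaurentField.
Variable K : comNzRingType.

(* K((u)); only its commutative ring structure is needed. *)
Definition laurent_field := laurent K.

HB.instance Definition _ := GRing.PzRing.on laurent_field.

Fact laurent_field_mulC (f g : laurent_field) : f * g = g * f.
Proof. by apply: laurent_comm => i j; exact: mulrC.
Qed.

HB.instance Definition _ :=
  GRing.PzRing_hasCommutativeMul.Build laurent_field laurent_field_mulC.

Definition laurent_field_scal (c : K) : laurent_field := laurent_mono 0 c.

Fact laurent_field_scalD c d :
  laurent_field_scal (c + d) = laurent_field_scal c + laurent_field_scal d.
Proof. exact: laurent_monoD. Qed.
Fact laurent_field_scalM c d :
  laurent_field_scal (c * d) = laurent_field_scal c * laurent_field_scal d.
Proof. by rewrite /laurent_field_scal [RHS]laurent_monoM addr0. Qed.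
Fact laurent_field_scal1 : laurent_field_scal 1 = 1.
Proof. by []. Qed.
Fact laurent_field_scalC c (f : laurent_field) :
  laurent_field_scal c * f = f * laurent_field_scal c.
Proof. exact: mulrC. Qed.

HB.instance Definition _ := PzRing_isPzAlgebra.Build K laurent_field
  laurent_field_scalD laurent_field_scalM laurent_field_scal1
  laurent_field_scalC.

End LaurentField.

Section BaseChange.
Variables (K : comNzRingType) (A : pzAlgType K).

Local Notation CC := (laurent_field K).

(* K((u)) ⊗_K A, as a K((u))-algebra *)
Definition base_change := tens (laurent_field K) A.

HB.instance Definition _ := GRing.PzRing.on base_change.

Definition base_change_scal (f : CC) : base_change := f ⊗ 1.

Fact base_change_scalD f g :
  base_change_scal (f + g) = base_change_scal f + base_change_scal g.
Proof. exact: pure_tensDl. Qed.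
Fact base_change_scalM f g :
  base_change_scal (f * g) = base_change_scal f * base_change_scal g.
Proof. by rewrite /base_change_scal [RHS]pure_tensM mulr1. Qed.
Fact base_change_scal1 : base_change_scal 1 = 1.
Proof. exact: pure_tens1. Qed.
Fact tens_scalC (f : CC) (x : tens CC A) : (f ⊗ 1) * x = x * (f ⊗ 1).
Proof.
elim/tens_ind: x => [g a|x y fx fy]; first by rewrite !pure_tensM mul1r mulr1 mulrC.
by rewrite mulrDr mulrDl fx fy.
Qed.
Fact base_change_scalC f (x : base_change) :
  base_change_scal f * x = x * base_change_scal f.
Proof. exact: tens_scalC. Qed.

HB.instance Definition _ := PzRing_isPzAlgebra.Build CC base_change
  base_change_scalD base_change_scalM base_change_scal1 base_change_scalC.

Definition base_emb (a : A) : base_change := 1 ⊗ a.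

(* The completed tensor product (A ⊗_K A)((u)), as a K((u))-algebra *)
Definition completed_tens := laurent (tens A A).

HB.instance Definition _ := GRing.PzRing.on completed_tens.

Fact completed_tens_scal_bounded (f : CC) :
  exists N : int, forall n, n < N -> scal (f n) = 0 :> tens A A.
Proof.
have [N fN] := laurent_bounded f; exists N => n /fN ->.
by apply: (addrI (scal 0)); rewrite -scalD !addr0.
Qed.
Definition completed_tens_scal (f : CC) : completed_tens :=
  Laurent (completed_tens_scal_bounded f).

Fact completed_tens_scalD f g :
  completed_tens_scal (f + g) = completed_tens_scal f + completed_tens_scal g.
Proof. by apply: laurentP => n /=; rewrite scalD. Qed.
Fact completed_tens_scalM f g :
  completed_tens_scal (f * g) = completed_tens_scal f * completed_tens_scal g.
Proof.
apply: laurentP => n /=.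
have scal0 : scal 0 = 0 :> tens A A.
  by apply: (addrI (scal 0)); rewrite -scalD !addr0.
have [N fN] := laurent_bounded f.
have [M gM] := laurent_bounded g.
pose k := (absz (n - N - M)%R).+1.
rewrite (@laurent_mul_coefE _ f g N M _ k fN gM); last by lia.
rewrite (@laurent_mul_coefE _ _ _ N M _ k) /=; last by lia.
- rewrite (big_morph scal (@scalD K (tens A A)) scal0).
  by apply: eq_bigr => i _; rewrite scalM.
- by move=> i /fN ->.
- by move=> i /gM ->.
Qed.
Fact completed_tens_scal1 : completed_tens_scal 1 = 1.
Proof.
apply: laurentP => n /=; case: ifP => _; first exact: scal1.
by apply: (addrI (scal 0)); rewrite -scalD !addr0.
Qed.
Fact completed_tens_scalC f (x : completed_tens) :
  completed_tens_scal f * x = x * completed_tens_scal f.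
Proof. by apply: laurent_comm => i j; exact: scalC.
Qed.

HB.instance Definition _ := PzRing_isPzAlgebra.Build CC completed_tens
  completed_tens_scalD completed_tens_scalM completed_tens_scal1
  completed_tens_scalC.

(* \sum_(l >= 0) u^(k + l) F l and u^k t *)
Definition useries (k : int) (F : nat -> tens A A) : completed_tens :=
  laurent_series k F.
Definition umono (k : int) (t : tens A A) : completed_tens := laurent_mono k t.

End BaseChange.

Definition cexp (R : realType) (z : R[i]) : R[i] :=
  let: (a +i* b)%C := z in ((expR a * cos b)%R +i* (expR a * sin b)%R)%C.

(* A symmetrizable generalized Cartan matrix, with a chosen symmetrization and
   a realization over rat. *)
Record realized_gcm := RealizedGCM {
  gcm_rank : nat;
  gcm_mx : 'M[int]_gcm_rank;
  gcm_diag : forall i, gcm_mx i i = 2;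
  gcm_offdiag : forall i j, i != j -> gcm_mx i j <= 0;
  gcm_zero : forall i j, gcm_mx i j = 0 <-> gcm_mx j i = 0;
  gcm_sym : 'I_gcm_rank -> nat;
  gcm_sym_gt0 : forall i, (0 < gcm_sym i)%N;
  gcm_symP : forall i j,
    (gcm_sym i)%:Z * gcm_mx i j = (gcm_sym j)%:Z * gcm_mx j i;
  cartan_space : vectType rat;
  cartan_space_dim : \dim {:cartan_space} =
    (2 * gcm_rank - \rank (map_mx intr gcm_mx : 'M[rat]_gcm_rank))%N;
  simple_root : 'I_gcm_rank -> 'Hom(cartan_space, rat^o);
  simple_coroot : 'I_gcm_rank -> cartan_space;
  simple_root_free : free [seq simple_root i | i <- enum 'I_gcm_rank];
  simple_coroot_free : free [seq simple_coroot i | i <- enum 'I_gcm_rank];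
  simple_root_coroot : forall i j, simple_root j (simple_coroot i) = (gcm_mx i j)%:~R
}.

Section Affinization.
(* lq is the chosen logarithm of q, used to define its rational powers. *)
Variables (R : realType) (D : realized_gcm) (q lq : R[i]).

Local Notation I := 'I_(gcm_rank D).
Local Notation H := (cartan_space D).

Definition qpow (a : rat) : R[i] := cexp (ratr a * lq).

Definition qint (z : R[i]) (m : int) : R[i] := (z ^ m - z ^ (- m)) / (z - z^-1).

Definition symB (i j : I) : int := (gcm_sym i)%:Z * gcm_mx D i j.
Definition qi (i : I) : R[i] := q ^+ gcm_sym i.

(* Signs are booleans, with true for + and false for -. *)
Definition sgb (s : bool) : int := if s then 1 else -1.

Inductive affine_gen :=
  | GenX of bool & I & int
  | GenK of H
  | GenH of I & {m : int | m != 0}.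

HB.instance Definition _ := gen_eqMixin affine_gen.
HB.instance Definition _ := gen_choiceMixin affine_gen.

Local Notation F := (free_alg R[i] affine_gen).

Definition xF s i r : F := free_var _ (GenX s i r).
Definition kF h : F := free_var _ (GenK h).
Definition hF i m : F := free_var _ (GenH i m).

(* The coefficient of z^m in exp (\sum_(b >= 1) a b z^b): the powers j > m and
   the terms b > m do not contribute to it. *)
Definition exp_coef (a : nat -> F) (m : nat) : F :=
  \sum_(j < m.+1) scal (j`!%:R^-1 : R[i]) *
    ((\poly_(b < m.+1) (if b == 0%N then 0 else a b)) ^+ j)`_m.

(* h_{i, m} for m != 0 *)
Definition hF0 i (m : int) : F := if insub m is Some m' then hF i m' else 0.

(* phi^+_{i, m} or phi^-_{i, m} according to the sign s; it vanishes when m has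
   the sign opposite to s. *)
Definition phiF (s : bool) (i : I) (m : int) : F :=
  if 0 <= sgb s * m then
    kF (((sgb s)%:~R * (gcm_sym i)%:R) *: simple_coroot i) *
    exp_coef (fun b => scal ((sgb s)%:~R * (q - q^-1)) * hF0 i (sgb s * b%:Z))
             `|m|%N
  else 0.

Inductive affine_rel : F -> F -> Prop :=
| rel_kk h h' : affine_rel (kF h * kF h') (kF (h + h'))
| rel_k0 : affine_rel (kF 0) 1
| rel_kh h j m : affine_rel (kF h * hF j m) (hF j m * kF h)
| rel_hh i m j m' : affine_rel (hF i m * hF j m') (hF j m' * hF i m)
| rel_kx h s j r :
    affine_rel (kF h * xF s j r * kF (- h))
               (scal (qpow ((sgb s)%:~R * simple_root j h)) * xF s j r)
| rel_hx i m s j r :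
    affine_rel (hF i m * xF s j r - xF s j r * hF i m)
               (scal ((sgb s)%:~R * (val m)%:~R^-1 * qint q (val m * symB i j))
                * xF s j (val m + r))
| rel_xx i r j r' :
    affine_rel (xF true i r * xF false j r' - xF false j r' * xF true i r)
               (if i == j then
                  scal (qi i - (qi i)^-1)^-1 *
                  (phiF true i (r + r') - phiF false i (r + r'))
                else 0)
| rel_quad s i r j r' :
    affine_rel
      (xF s i (r + 1) * xF s j r'
         - scal (q ^ (sgb s * symB i j)) * (xF s j r' * xF s i (r + 1)))
      (scal (q ^ (sgb s * symB i j)) * (xF s i r * xF s j (r' + 1))
         - xF s j (r' + 1) * xF s i r).

Definition Uaff := alg_quot affine_rel.

HB.instance Definition _ := PzAlgebra.on Uaff.

Definition x_ s i r : Uaff := alg_pi affine_rel (xF s i r).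
Definition k_ h : Uaff := alg_pi affine_rel (kF h).
Definition phi_ s i m : Uaff := alg_pi affine_rel (phiF s i m).

End Affinization.

(* Main.v *)
(* In generating series the required map is the Drinfeld coproduct
     x^+(z) |-> x^+(z) ⊗ 1 + phi^-(z) ⊗ x^+(u z),
     x^-(z) |-> 1 ⊗ x^-(u z) + x^-(z) ⊗ phi^+(u z),
     phi^s(z) |-> phi^s(z) ⊗ phi^s(u z).
   Taking logarithms in the last formula forces h_{i,m} |-> h_{i,m} ⊗ 1 +
   u^m (1 ⊗ h_{i,m}), as q - q^-1 is invertible; this gives uniqueness, and for
   existence it remains to check the defining relations on these images. Every
   image is a sum of series f(z) ⊗ g(u z), whose u^n-coefficient in degree r is
   f_{r-n} ⊗ g_n.
   The relation [h, x^s] yields (w - Q z) phi^t_i(z) x^s_j(w) =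
   (Q w - z) x^s_j(w) phi^t_i(z) with Q = q^(s B_ij), of the same shape as the
   quadratic relation for x, and this shape passes to f(z) ⊗ g(u z) as soon as
   it holds on one tensor factor and the other factors commute. In [x^+, x^-]
   the terms x^+ ⊗ 1 and 1 ⊗ x^- commute, and so do phi^- ⊗ x^+ and x^- ⊗ phi^+
   because the factors (Q w - z) / (w - Q z) coming from both sides are inverse;
   the two remaining brackets telescope to phi^+ ⊗ phi^+ - phi^- ⊗ phi^-. *)
Require Import Defs.
From HB Require Import structures.
From mathcomp Require Import all_boot all_order all_algebra.
From mathcomp Require Import boolp classical_sets fsbigop reals.
From mathcomp Require Import exp trigo complex finmap monalg zify ring.

Set Implicit Arguments.
Unset Strict Implicit.
Unset Printing Implicit Defensive.

Import Order.TTheory GRing.Theory Num.Theory.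
Local Open Scope ring_scope.

(** * Morphisms of algebras and universal properties *)

Section PzAlgebraTheory.
Variables (K : pzRingType) (A : pzAlgType K).

Lemma scal0 : scal 0 = 0 :> A.
Proof. by apply: (addrI (scal 0)); rewrite -scalD !addr0. Qed.

Lemma scalN (c : K) : scal (- c) = - scal c :> A.
Proof. by apply: (addrI (scal c)); rewrite -scalD !subrr scal0. Qed.

Lemma scalMn (c : K) n : scal (c *+ n) = scal c *+ n :> A.
Proof. by elim: n => [|n IHn]; rewrite ?scal0 // !mulrS scalD IHn. Qed.

Lemma scal_nat n : scal n%:R = n%:R :> A.
Proof. by rewrite scalMn scal1. Qed.

Lemma scalCA (c : K) (x y : A) : x * (scal c * y) = scal c * (x * y).
Proof. by rewrite !mulrA scalC. Qed.

End PzAlgebraTheory.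

Lemma scal_mulr_eq0 (K : fieldType) (A : pzAlgType K) (c : K) (x : A) :
  c != 0 -> scal c * x = 0 -> x = 0.
Proof.
move=> c0 /(congr1 ( *%R (scal c^-1))).
by rewrite mulr0 mulrA -scalM mulVf // scal1 mul1r.
Qed.

Section Morphism.
Variables (K : pzRingType) (A B C : pzAlgType K) (f : A -> B).
Hypothesis fP : alg_morphism f.

Lemma alg_morphD x y : f (x + y) = f x + f y. Proof. by case: fP. Qed.
Lemma alg_morphM x y : f (x * y) = f x * f y. Proof. by case: fP. Qed.
Lemma alg_morph_scal c : f (scal c) = scal c. Proof. by case: fP. Qed.
Lemma alg_morph0 : f 0 = 0.
Proof. by rewrite -(scal0 A) alg_morph_scal scal0. Qed.
Lemma alg_morph1 : f 1 = 1.
Proof. by rewrite -(scal1 (s := A)) alg_morph_scal scal1. Qed.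
Lemma alg_morphN x : f (- x) = - f x.
Proof. by apply: (addrI (f x)); rewrite -alg_morphD !subrr alg_morph0. Qed.
Lemma alg_morphB x y : f (x - y) = f x - f y.
Proof. by rewrite alg_morphD alg_morphN. Qed.
Lemma alg_morphZ c x : f (scal c * x) = scal c * f x.
Proof. by rewrite alg_morphM alg_morph_scal. Qed.
Lemma alg_morph_sum I r (P : pred I) F :
  f (\sum_(i <- r | P i) F i) = \sum_(i <- r | P i) f (F i).
Proof. exact: (big_morph f alg_morphD alg_morph0). Qed.
Lemma alg_morph_prod I r (P : pred I) F :
  f (\prod_(i <- r | P i) F i) = \prod_(i <- r | P i) f (F i).
Proof. exact: (big_morph f alg_morphM alg_morph1). Qed.

Lemma alg_morphM_eq x y x' y' : f x = x' -> f y = y' -> f (x * y) = x' * y'.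
Proof. by move=> <- <-; exact: alg_morphM. Qed.
Lemma alg_morphB_eq x y x' y' : f x = x' -> f y = y' -> f (x - y) = x' - y'.
Proof. by move=> <- <-; exact: alg_morphB. Qed.
Lemma alg_morphZ_eq c x x' : f x = x' -> f (scal c * x) = scal c * x'.
Proof. by move=> <-; exact: alg_morphZ. Qed.

Lemma alg_morph_comp (g : B -> C) : alg_morphism g -> alg_morphism (g \o f).
Proof.
case: fP => fD fM fc [gD gM gc].
by split=> [x y|x y|c] /=; rewrite ?fD ?fM ?fc ?gD ?gM ?gc.
Qed.

End Morphism.

(** Both sides are additive in each variable, so the product rule needs checking only on the
    additive generators singled out by [W]. *)
Lemma additive_morphM (A B : pzRingType) (f : A -> B) (W : A -> Prop) :
  f 0 = 0 -> {morph f : x y / x + y} ->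
  (forall P : A -> Prop, P 0 -> (forall x y, P x -> P y -> P (x + y)) ->
     (forall x, W x -> P x) -> forall x, P x) ->
  (forall x y, W x -> W y -> f (x * y) = f x * f y) ->
  {morph f : x y / x * y}.
Proof.
move=> f0 fD indW fW x y; elim/indW: x => [|x x' IHx IHx'|x Wx].
- by rewrite mul0r f0 mul0r.
- by rewrite mulrDl !fD mulrDl IHx IHx'.
elim/indW: y => [|y y' IHy IHy'|y Wy]; last exact: fW.
- by rewrite mulr0 f0 mulr0.
- by rewrite mulrDr !fD mulrDr IHy IHy'.
Qed.

Section FreeLift.
Variables (K : comNzRingType) (I : choiceType) (B : pzAlgType K) (v : I -> B).

Definition free_lift (x : free_alg K I) : B :=
  \sum_(k <- msupp x) scal (x@_k) * \prod_(i <- (k : seq I)) v i.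

Local Notation w k := (\prod_(i <- (k : seq I)) v i).

(** Coefficients vanish off the support, so any larger finite set may index the sum; two elements
    can then be expanded over a common set. *)
Lemma free_liftEw (d : {fset {fmonom I}}) (x : free_alg K I) :
  (msupp x `<=` d)%fset -> free_lift x = \sum_(k <- d) scal (x@_k) * w k.
Proof.
move=> xd; rewrite /free_lift (big_fset_incl _ xd) //= => k _ /mcoeff_outdom ->.
by rewrite scal0 mul0r.
Qed.

Lemma free_liftD : {morph free_lift : x y / x + y}.
Proof.
move=> x y; pose d := (msupp x `|` msupp y)%fset.
rewrite !(free_liftEw (d := d)) ?fsubsetUl ?fsubsetUr ?msuppD_le //.
by rewrite -big_split; apply: eq_bigr => k _; rewrite mcoeffD scalD mulrDl.
Qed.

Lemma free_liftU (c : K) (k : {fmonom I}) :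
  free_lift (<< c *g k >> : free_alg K I) = scal c * w k.
Proof. by rewrite (free_liftEw msuppU_le) big_seq_fset1 mcoeffUU. Qed.

Lemma free_lift_scal (c : K) : free_lift (scal c) = scal c.
Proof.
by rewrite [scal c]free_scalE free_liftU fm1 big_nil mulr1.
Qed.

Lemma free_lift_var i : free_lift (free_var K i) = v i.
Proof. by rewrite free_liftU scal1 mul1r fmU big_seq1. Qed.

Lemma free_lift_word (c : K) (s : seq I) :
  scal c * \prod_(i <- s) free_var K i = << c *g FMonom s >> :> free_alg K I.
Proof.
elim: s c => [|i s IHs] c.
  by rewrite big_nil mulr1 [scal c]free_scalE /mone /= fmoneE.
rewrite big_cons mulrA scalC -mulrA IHs malgM_def fgmulUU mul1r.
by congr (<< _ *g _ >>); rewrite /mmul /= fmmulE fmuE.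
Qed.

Lemma free_lift0 : free_lift 0 = 0.
Proof. by rewrite /free_lift msupp0 big_seq_fset0. Qed.

Lemma free_liftM : {morph free_lift : x y / x * y}.
Proof.
apply: (additive_morphM (W := fun x => exists c s, x = << c *g FMonom s >>)).
- exact: free_lift0.
- exact: free_liftD.
- move=> P P0 PD PW; apply: free_alg_ind => // c s.
  by apply: PW; exists c, s; exact: free_lift_word.
- move=> _ _ [c [s ->]] [d [t ->]].
  rewrite malgM_def fgmulUU 3!free_liftU fmM big_cat scalM -!mulrA.
  by congr (_ * _); rewrite scalCA.
Qed.

Lemma free_lift_morphism : alg_morphism free_lift.
Proof. by split; [exact: free_liftD|exact: free_liftM|exact: free_lift_scal]. Qed.

End FreeLift.

Lemma free_morph_eq (K : comNzRingType) (I : choiceType) (B : pzAlgType K)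
    (f g : free_alg K I -> B) :
  alg_morphism f -> alg_morphism g ->
  (forall i, f (free_var K i) = g (free_var K i)) -> f =1 g.
Proof.
move=> fP gP fg; elim/free_alg_ind => [|x y fgx fgy|c s].
- by rewrite (alg_morph0 fP) (alg_morph0 gP).
- by rewrite (alg_morphD fP) (alg_morphD gP) fgx fgy.
rewrite (alg_morphZ fP) (alg_morphZ gP) (alg_morph_prod fP) (alg_morph_prod gP).
by congr (_ * _); apply: eq_bigr => i _; exact: fg.
Qed.

Section QuotLift.
Variables (K : pzRingType) (A B : pzAlgType K) (E : A -> A -> Prop).
Variable f : A -> B.
Hypothesis fP : alg_morphism f.
Hypothesis fE : forall a b, E a b -> f a = f b.

(** Evaluation at a chosen representative is always defined; compatibility of [f] with [E] enters
    only in [quot_lift_pi], which shows that the choice does not matter. *)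
Definition quot_lift (x : alg_quot E) : B := f (repr x).

Lemma alg_cong_morph a b : alg_cong E a b -> f a = f b.
Proof.
elim=> [? ? /fE //|//|//|? ? ? _ -> //|*|*].
  by rewrite !(alg_morphD fP); congr (_ + _).
by rewrite !(alg_morphM fP); congr (_ * _).
Qed.

Lemma quot_lift_pi a : quot_lift (alg_pi E a) = f a.
Proof. exact/alg_cong_morph/alg_cong_repr. Qed.

Lemma quot_lift_morphism : alg_morphism quot_lift.
Proof.
split=> [x y|x y|c].
- elim/alg_quotW: x => x; elim/alg_quotW: y => y.
  by rewrite -alg_piD !quot_lift_pi (alg_morphD fP).
- elim/alg_quotW: x => x; elim/alg_quotW: y => y.
  by rewrite -alg_piM !quot_lift_pi (alg_morphM fP).
- by rewrite [scal c]/(alg_pi E (scal c)) quot_lift_pi (alg_morph_scal fP).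
Qed.

End QuotLift.

Section TensLift.
Variables (K : comNzRingType) (A B C : pzAlgType K) (f : A -> C) (g : B -> C).
Hypothesis fP : alg_morphism f.
Hypothesis gP : alg_morphism g.
Hypothesis fgC : forall a b, f a * g b = g b * f a.

Let w := free_lift (fun ab : (A * B)%type => f ab.1 * g ab.2).

Definition tens_lift : tens A B -> C := quot_lift (E := @tens_rel K A B) w.

Let wP : alg_morphism w. Proof. exact: free_lift_morphism. Qed.

Let wv a b : w (free_var K (a, b)) = f a * g b.
Proof. exact: free_lift_var. Qed.

Let wE x y : tens_rel x y -> w x = w y.
Proof.
case=> [|a a' b b'|a a' b|a b b'|c a b|c a b].
- by rewrite wv (alg_morph1 fP) (alg_morph1 gP) mulr1; exact/esym/alg_morph1.
- rewrite alg_morphM // 3!wv (alg_morphM fP) (alg_morphM gP) -!mulrA.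
  by congr (_ * _); rewrite !mulrA fgC.
- by rewrite (alg_morphD wP) 3!wv (alg_morphD fP) mulrDl.
- by rewrite (alg_morphD wP) 3!wv (alg_morphD gP) mulrDr.
- by rewrite (alg_morphZ wP) 2!wv (alg_morphZ fP) mulrA.
- by rewrite (alg_morphZ wP) 2!wv (alg_morphZ gP) scalCA.
Qed.

Lemma tens_lift_pure a b : tens_lift (a ⊗ b) = f a * g b.
Proof. by rewrite /tens_lift quot_lift_pi. Qed.

Lemma tens_lift_morphism : alg_morphism tens_lift.
Proof. exact: quot_lift_morphism. Qed.

End TensLift.

(** * Exponentials of commuting series *)

(* The coefficient of z^m in (\sum_(b >= 1) a b z^b)^j. *)
Fixpoint pow_coef (A : pzRingType) (a : nat -> A) (j m : nat) : A :=
  if j is j'.+1 then \sum_(b < m) a b.+1 * pow_coef a j' (m - b.+1)%N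
  else (m == 0%N)%:R.

(** Connects the truncated polynomials of [exp_coef] with the recursion: truncation at degree [n]
    leaves the coefficients of powers below [n] unchanged. *)
Lemma poly_exp_coef (A : nzRingType) (a : nat -> A) (n j m : nat) : (m < n)%N ->
  ((\poly_(b < n) (if b == 0%N then 0 else a b)) ^+ j)`_m = pow_coef a j m.
Proof.
elim: j m => [|j IHj] m mn; first by rewrite expr0 coef1.
rewrite exprS coefM big_ord_recl coef_poly /= if_same mul0r add0r.
apply: eq_bigr => b _; have bm := ltn_ord b.
by rewrite /bump add1n coef_poly (leq_ltn_trans bm mn) IHj //; lia.
Qed.

Section ExpCoef.
Variables (K : numFieldType) (A : pzAlgType K).
Implicit Types (a : nat -> A) (j m : nat).

Lemma pzalg_mulrnI m (x y : A) : x *+ m.+1 = y *+ m.+1 -> x = y.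
Proof.
have E (z : A) : z = scal (m.+1%:R^-1 : K) * (z *+ m.+1).
  rewrite -[z *+ _]mulr_natl -(scal_nat A) mulrA -scalM mulVf ?scal1 ?mul1r //.
  by rewrite pnatr_eq0.
by move=> xy; rewrite (E x) xy -E.
Qed.

(** The coefficient [exp_coef], formed through [pow_coef] so that it makes sense in every K-algebra,
    also in the zero algebra. *)
Definition expc a m : A :=
  \sum_(j < m.+1) scal (j`!%:R^-1 : K) * pow_coef a j m.

Lemma pow_coef_small a j m : (m < j)%N -> pow_coef a j m = 0.
Proof.
elim: j m => //= j IHj m mj; apply: big1 => b _.
by rewrite IHj ?mulr0 //; have := ltn_ord b; lia.
Qed.

Lemma expcE a m n : (m <= n)%N ->
  expc a m = \sum_(j < n.+1) scal (j`!%:R^-1 : K) * pow_coef a j m.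
Proof.
move=> mn; rewrite /expc (big_ord_widen n.+1
  (fun j => scal (j`!%:R^-1 : K) * pow_coef a j m)) //.
rewrite big_mkcond; apply: eq_bigr => j _; case: ifP => // /negbT.
by rewrite -leqNgt => mj; rewrite pow_coef_small ?mulr0.
Qed.

Lemma expc0 a : expc a 0 = 1.
Proof. by rewrite /expc big_ord1 /= fact0 invr1 scal1 mulr1. Qed.

(* E(z) = exp (\sum_(b >= 1) a b z^b) is characterized by the differential
   equation z E'(z) = (\sum_(b >= 1) b a b z^b) E(z) and E(0) = 1. *)
Definition exp_rec a (E : nat -> A) := E 0%N = 1 /\
  forall m, E m.+1 *+ m.+1 = \sum_(b < m.+1) a b.+1 * E (m - b)%N *+ b.+1.

Lemma exp_rec_uniq a E E' : exp_rec a E -> exp_rec a E' -> E =1 E'.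
Proof.
move=> [E0 ES] [E'0 E'S] m; elim/ltn_ind: m => -[|m] IHm; first by rewrite E0.
apply: (@pzalg_mulrnI m); rewrite ES E'S; apply: eq_bigr => b _.
by rewrite IHm // ltnS leq_subr.
Qed.

(** The logarithm is determined by the series: in the equation for index [b] the coefficient
    [a b.+1] is multiplied by [E 0 = 1], and the other terms involve earlier coefficients of [a]
    only. *)
Lemma exp_rec_inj a a' E b : exp_rec a E -> exp_rec a' E -> a b.+1 = a' b.+1.
Proof.
move=> [E0 ES] [_ E'S]; elim/ltn_ind: b => b IHb.
apply: (@pzalg_mulrnI b); have := E'S b; rewrite ES !big_ord_recr /=.
rewrite subnn E0 !mulr1 => eq_sum.
apply: (addrI (\sum_(i < b) a i.+1 * E (b - i)%N *+ i.+1)); rewrite eq_sum.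
by congr (_ + _); apply: eq_bigr => i _; rewrite IHb.
Qed.

Variable a : nat -> A.
Hypothesis aC : forall b c, a b * a c = a c * a b.

(* z (P^(j+1))' = (j+1) (z P') P^j *)
Lemma pow_coef_deriv j m : pow_coef a j.+1 m *+ m =
  \sum_(b < m) (a b.+1 * pow_coef a j (m - b.+1) *+ b.+1) *+ j.+1.
Proof.
elim: j m => [|j IHj] m.
  rewrite /= -sumrMnl; apply: eq_bigr => b _.
  have [mb|mb] := eqVneq m b.+1; first by rewrite mulr1n; congr (_ *+ _).
  by rewrite (_ : (m - b.+1 == 0)%N = false) ?mulr0 ?mul0rn //; have := ltn_ord b; lia.
pose t b c := a b.+1 * (a c.+1 * pow_coef a j (m - b.+1 - c.+1)).
have tC b c : t b c = t c b.
  by rewrite /t !mulrA aC; congr (_ * _ * pow_coef _ _ _); lia.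
(* The factor [m] splits as [b.+1 + (m - b.+1)]: the derivation z d/dz falls on the first factor or
   on the remaining power, where the induction hypothesis applies. *)
transitivity (\sum_(b < m) (a b.+1 * pow_coef a j.+1 (m - b.+1) *+ b.+1
   + \sum_(c < m - b.+1) (t b c *+ c.+1) *+ j.+1)).
  rewrite -sumrMnl; apply: eq_bigr => b _.
  rewrite -[X in _ *+ X = _](subnKC (ltn_ord b)) mulrnDr; congr (_ + _).
  rewrite -mulrnAr IHj mulr_sumr.
  by apply: eq_bigr => c _; rewrite /t !mulrnAr.
rewrite big_split /=.
(* Exchanging the sums and using the symmetry of [t] turns the second part into [j.+1] copies of the
   first. *)
have -> : \sum_(b < m) \sum_(c < m - b.+1) t b c *+ c.+1 *+ j.+1 =
          \sum_(b < m) a b.+1 * pow_coef a j.+1 (m - b.+1) *+ b.+1 *+ j.+1.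
  transitivity (\sum_(b < m) \sum_(c < m | (b + c + 2 <= m)%N) t b c *+ c.+1 *+ j.+1).
    apply: eq_bigr => b _.
    rewrite (big_ord_widen m (fun c => t b c *+ c.+1 *+ j.+1)) ?leq_subr //.
    by apply: eq_bigl => c; have := ltn_ord b; lia.
  rewrite (exchange_big_dep xpredT) //=; apply: eq_bigr => c _.
  rewrite -!mulrnA mulr_sumr -sumrMnl.
  rewrite (big_ord_widen m (fun b =>
    a c.+1 * (a b.+1 * pow_coef a j (m - c.+1 - b.+1)) *+ _)) ?leq_subr //.
  apply: eq_big => b; first by have := ltn_ord c; lia.
  by rewrite -/(t c b) tC mulrnA.
rewrite -big_split; apply: eq_bigr => b _ /=.
by rewrite [RHS]mulrS.
Qed.

(** Termwise differentiation: the factor [j.+1] from [pow_coef_deriv] cancels against (j+1)! and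
    leaves the exponential series again. *)
Lemma expc_rec : exp_rec a (expc a).
Proof.
split=> [|m]; first exact: expc0.
rewrite [expc a m.+1]/expc big_ord_recl /= mulr0 add0r -sumrMnl.
transitivity (\sum_(j < m.+1) \sum_(b < m.+1)
    scal (j`!%:R^-1 : K) * (a b.+1 * pow_coef a j (m - b) *+ b.+1)).
  apply: eq_bigr => j _; rewrite /bump add1n.
  rewrite -mulrnAr pow_coef_deriv.
  rewrite mulr_sumr; apply: eq_bigr => b _.
  rewrite subSS -[X in scal _ * X = _]mulr_natl -(scal_nat A) mulrA -scalM.
  by rewrite factS natrM invfM mulrAC mulVf ?mul1r // pnatr_eq0.
rewrite exchange_big; apply: eq_bigr => b _ /=.
rewrite (expcE a (leq_subr b m)) mulr_sumr -sumrMnl; apply: eq_bigr => j _.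
by rewrite scalCA mulrnAr.
Qed.

End ExpCoef.

Section ExpMorph.
Variables (K : numFieldType) (A B : pzAlgType K).

Lemma alg_morph_nat (f : A -> B) n : alg_morphism f -> f n%:R = n%:R.
Proof. by move=> fP; rewrite -scal_nat (alg_morph_scal fP) scal_nat. Qed.

Lemma expc_morph (f : A -> B) (a : nat -> A) m : alg_morphism f ->
  f (expc a m) = expc (f \o a) m.
Proof.
move=> fP; rewrite /expc (alg_morph_sum fP); apply: eq_bigr => j _.
rewrite (alg_morphZ fP); congr (_ * _).
case: j => j /= _; elim: j m => [|j IHj] m /=; first exact: alg_morph_nat.
by rewrite (alg_morph_sum fP); apply: eq_bigr => b _; rewrite (alg_morphM fP) IHj.
Qed.

Lemma eq_expc (a a' : nat -> A) m : (forall b, a b.+1 = a' b.+1) ->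
  expc a m = expc a' m.
Proof.
move=> aa; apply: eq_bigr => j _; congr (_ * _).
case: j => j /= _; elim: j m => //= j IHj m.
by apply: eq_bigr => b _; rewrite IHj aa.
Qed.

Lemma expc_comm (a : nat -> A) (y : A) m : (forall b, a b * y = y * a b) ->
  expc a m * y = y * expc a m.
Proof.
move=> ay; rewrite /expc mulr_sumr mulr_suml; apply: eq_bigr => j _.
rewrite scalCA -mulrA; congr (_ * _).
case: j => j /= _; elim: j m => [|j IHj] m /=.
  by case: (m == 0%N); rewrite ?mulr1 ?mul1r ?mulr0 ?mul0r.
rewrite mulr_sumr mulr_suml; apply: eq_bigr => b _.
by rewrite -mulrA IHj !mulrA ay.
Qed.

(** By the Leibniz rule the Cauchy product [G] solves the differential equation attached to a + a',
    and that equation has only one solution. *)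
Lemma expcD (a a' : nat -> A) m :
  (forall b c, a b * a c = a c * a b) -> (forall b c, a' b * a' c = a' c * a' b) ->
  (forall b c, a b * a' c = a' c * a b) ->
  expc (fun b => a b + a' b) m = \sum_(l < m.+1) expc a (m - l) * expc a' l.
Proof.
move=> aC a'C aa'C; pose G m := \sum_(l < m.+1) expc a (m - l) * expc a' l.
have sumC b c : (a b + a' b) * (a c + a' c) = (a c + a' c) * (a b + a' b).
  by rewrite !mulrDl !mulrDr aC a'C !aa'C addrACA [a' c * a b + _]addrC addrACA.
suff recG : exp_rec (fun b => a b + a' b) G.
  by apply: (exp_rec_uniq _ recG); exact: expc_rec.
have [E0 ES] := expc_rec aC; have [E'0 E'S] := expc_rec a'C.
split=> [|{}m]; first by rewrite /G big_ord1 E0 E'0 mulr1.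
(* Leibniz rule: [m.+1] is distributed as [(m.+1 - l) + l] over the two factors. *)
transitivity (\sum_(l < m.+2) (expc a (m.+1 - l) *+ (m.+1 - l) * expc a' l
     + expc a (m.+1 - l) * (expc a' l *+ l))).
  rewrite /G -sumrMnl; apply: eq_bigr => l _.
  by rewrite mulrnAr mulrnAl -mulrnDr subnK // -ltnS.
rewrite big_split /= big_ord_recr /= subnn mulr0n mul0r addr0.
rewrite [X in _ + X]big_ord_recl /= mulr0n mulr0 add0r.
under [RHS]eq_bigr do rewrite mulrDl mulrnDl.
rewrite big_split /=; congr (_ + _).
  transitivity (\sum_(l < m.+1) \sum_(b < m.+1 | (b + l <= m)%N)
     a b.+1 * (expc a (m - l - b) * expc a' l) *+ b.+1).
    apply: eq_bigr => l _; have lm : (l <= m)%N by rewrite -ltnS.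
    rewrite subSn // ES mulr_suml.
    rewrite (big_ord_widen m.+1 (fun b =>
      a b.+1 * expc a (m - l - b) *+ b.+1 * expc a' l)); last by lia.
    by apply: eq_big => [b|b _]; [lia | rewrite mulrnAl mulrA].
  rewrite (exchange_big_dep xpredT) //=; apply: eq_bigr => b _.
  rewrite /G mulr_sumr -sumrMnl.
  rewrite (big_ord_widen m.+1 (fun l =>
    a b.+1 * (expc a (m - b - l) * expc a' l) *+ b.+1)); last by lia.
  by apply: eq_big => [l|l _]; [have := ltn_ord b; lia | rewrite subnAC].
transitivity (\sum_(l < m.+1) \sum_(b < m.+1 | (b <= l)%N)
     a' b.+1 * (expc a (m - l) * expc a' (l - b)) *+ b.+1).
  apply: eq_bigr => l _; rewrite /bump add1n subSS E'S mulr_sumr.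
  rewrite (big_ord_widen m.+1 (fun b =>
    expc a (m - l) * (a' b.+1 * expc a' (l - b) *+ b.+1))); last exact: ltn_ord.
  apply: eq_big => [b|b _]; first by [].
  by rewrite mulrnAr !mulrA expc_comm // => c; rewrite aa'C.
rewrite (exchange_big_dep xpredT) //=; apply: eq_bigr => b _.
rewrite /G mulr_sumr -sumrMnl.
have bm : (b < m.+1)%N by [].
rewrite -(big_mkord (fun l => (b <= l)%N) (fun l =>
  a' b.+1 * (expc a (m - l) * expc a' (l - b)) *+ b.+1)).
rewrite (big_cat_nat _ (n := b)) ?(ltnW bm) //= big_nat_cond big1 ?add0r; last first.
  by move=> l /andP[/andP[_ lb]]; rewrite leqNgt lb.
rewrite -{1}[val b]add0n big_addn subSn // big_mkord.
by apply: eq_big => [l|l _]; rewrite ?leq_addl // addnK addnC subnDA.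
Qed.

(** The [t b] behave like powers of one element commuting with every [a c], so this is the rescaling
    of z by [t 1]; the rescaled series solves the rescaled differential equation. *)
Lemma expc_grade (a : nat -> A) (t : nat -> A) m :
  (forall b c, a b * a c = a c * a b) -> (forall b c, t b * a c = a c * t b) ->
  t 0%N = 1 -> (forall b c, t b * t c = t (b + c)%N) ->
  expc (fun b => t b * a b) m = t m * expc a m.
Proof.
move=> aC taC t0 tD; have [E0 ES] := expc_rec aC.
have taC2 b c : t b * a b * (t c * a c) = t c * a c * (t b * a b).
  rewrite -!mulrA [a b * _]mulrA -taC [a c * (t b * _)]mulrA -taC -!mulrA aC.
  by rewrite !mulrA !tD addnC.
suff rect : exp_rec (fun b => t b * a b) (fun m => t m * expc a m).
  by apply: (exp_rec_uniq _ rect); exact: expc_rec.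
split=> [|{}m]; first by rewrite t0 E0 mulr1.
rewrite -mulrnAr ES mulr_sumr; apply: eq_bigr => b _.
rewrite -mulrA [a _ * (t _ * _)]mulrA -taC !mulrA tD mulrnAr !mulrA.
by congr (t _ * _ * _ *+ _); have := ltn_ord b; lia.
Qed.

End ExpMorph.

(** * Laurent series and quadratic relations *)

HB.instance Definition _ (K : pzRingType) (A : pzAlgType K) :=
  GRing.PzRing.on (laurent A).

Lemma laurent_coefM_small (A : pzRingType) (f g : laurent A) N M n :
  (forall i, i < N -> f i = 0) -> (forall i, i < M -> g i = 0) ->
  n < N + M -> (f * g) n = 0.
Proof.
move=> fN gM nNM; apply: etrans (laurent_mul_coefE (k := 0) fN gM _) _; first lia.
by rewrite big_ord0.
Qed.

Section LaurentAlgebra.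
Variables (K : pzRingType) (A : pzAlgType K).

(** Gives A((u)) its structure over the base ring K; the structure over K((u)) is carried by the
    separate type [completed_tens]. *)
Definition laurent_scal (c : K) : laurent A := laurent_mono 0 (scal c).

Fact laurent_scalD c d : laurent_scal (c + d) = laurent_scal c + laurent_scal d.
Proof. by rewrite /laurent_scal scalD laurent_monoD. Qed.
Fact laurent_scalM c d : laurent_scal (c * d) = laurent_scal c * laurent_scal d.
Proof. by rewrite /laurent_scal scalM laurent_monoM addr0. Qed.
Fact laurent_scal1 : laurent_scal 1 = 1.
Proof. by rewrite /laurent_scal scal1. Qed.
Fact laurent_scalC c (x : laurent A) : laurent_scal c * x = x * laurent_scal c.
Proof.
apply: laurent_comm => i j /=.
by case: ifP => _; [exact: scalC | rewrite mul0r mulr0].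
Qed.

HB.instance Definition _ := PzRing_isPzAlgebra.Build K (laurent A)
  laurent_scalD laurent_scalM laurent_scal1 laurent_scalC.

Lemma laurent_coefM (f g : laurent A) n : (f * g) n = laurent_mul_coef f g n.
Proof. by []. Qed.

Lemma laurent_coefB (f g : laurent A) n : (f - g) n = f n - g n.
Proof. by []. Qed.

Lemma laurent_coef_sum J (r : seq J) (P : pred J) (F : J -> laurent A) n :
  (\sum_(j <- r | P j) F j) n = \sum_(j <- r | P j) F j n.
Proof.
apply: (big_morph (fun f : laurent A => f n)) => [f g|]; first exact: laurent_coefD.
exact: laurent_coef0.
Qed.

Lemma laurent_coefZ c (f : laurent A) n : (scal c * f) n = scal c * f n.
Proof. by rewrite laurent_coefM laurent_mono_mulE subr0. Qed.

Lemma laurent_mono_coefM j a (f : laurent A) n :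
  (laurent_mono j a * f) n = a * f (n - j).
Proof. exact: laurent_mono_mulE. Qed.

Lemma laurent_coefM_mono (f : laurent A) j a n :
  (f * laurent_mono j a) n = f (n - j) * a.
Proof.
have -> : laurent_mono j a = laurent_mono 0 a * laurent_mono j 1.
  by rewrite laurent_monoM add0r mulr1.
rewrite mulrA (@laurent_comm _ _ (laurent_mono j 1)) ?laurent_mono_mulE.
  by rewrite laurent_mono_coefM mul1r laurent_coefM laurent_mulr_mono0.
by move=> i k /=; case: ifP => _; rewrite ?mulr1 ?mul1r ?mulr0 ?mul0r.
Qed.

End LaurentAlgebra.

(** * Finitely supported sums over the integers *)

Section BilateralSum.
Variables (K : pzRingType) (A : pzAlgType K).
Implicit Types F G : int -> A.

(** Summing over all integers makes index shifts free of boundary terms. The value is 0 by default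
    on infinite support, hence the hypotheses [finitely_supported] below. *)
Definition zsum F : A := (\sum_(i \in [set: int]) F i)%R.

Definition finitely_supported F :=
  exists k : nat, forall i, (k < `|i|)%N -> F i = 0.

Let window (k : nat) : seq int := [seq i%:Z - k%:Z | i <- iota 0 (2 * k).+1].

Lemma zsumE F k : (forall i, (k < `|i|)%N -> F i = 0) ->
  zsum F = \sum_(i <- window k) F i.
Proof.
move=> F0; rewrite /zsum (fsbigE (window k)).
- by rewrite big_mkcond; apply: eq_bigr => i _; rewrite in_setT.
- by rewrite map_inj_uniq ?iota_uniq // => i j /addIr [].
- by [].
move=> i _ ik; apply: F0; rewrite ltnNge; apply: contra ik => ik.
by apply/mapP; exists (absz (i + k%:Z)%R); [rewrite mem_iota; lia | lia].
Qed.

Lemma eq_zsum F G : F =1 G -> zsum F = zsum G.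
Proof. by move=> FG; apply: eq_fsbigr => i _; exact: FG. Qed.

Lemma zsumD F G : finitely_supported F -> finitely_supported G ->
  zsum F + zsum G = zsum (fun i => F i + G i).
Proof.
move=> [k F0] [l G0]; rewrite !(@zsumE _ (maxn k l)) ?big_split //.
- by move=> i; rewrite gtn_max => /andP[/F0 -> /G0 ->]; rewrite addr0.
- by move=> i; rewrite gtn_max => /andP[_ /G0].
- by move=> i; rewrite gtn_max => /andP[/F0].
Qed.

Lemma zsumZ c F : finitely_supported F ->
  scal c * zsum F = zsum (fun i => scal c * F i).
Proof.
move=> [k F0]; rewrite !(@zsumE _ k) ?mulr_sumr // => i /F0 ->.
by rewrite mulr0.
Qed.

Lemma zsum_shift F : zsum F = zsum (fun i => F (i + 1)).
Proof.
apply: (@reindex_fsbigT _ _ _ _ _ (fun i : int => i + 1)).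
by exists (fun i => i - 1) => i; rewrite ?addrK ?subrK.
Qed.

Lemma fs_shift F : finitely_supported F ->
  finitely_supported (fun i => F (i + 1)).
Proof. by move=> [k F0]; exists k.+1 => i ik; apply: F0; lia. Qed.

Lemma fsD F G : finitely_supported F -> finitely_supported G ->
  finitely_supported (fun i => F i + G i).
Proof.
move=> [k F0] [l G0]; exists (maxn k l) => i.
by rewrite gtn_max => /andP[/F0 -> /G0 ->]; rewrite addr0.
Qed.

Lemma fs_between F (N M : int) : (forall i, i < N -> F i = 0) ->
  (forall i, M < i -> F i = 0) -> finitely_supported F.
Proof.
move=> FN FM; exists (`|N| + `|M|)%N => i iNM.
by have [/FN//|Ni] := ltP i N; apply: FM; lia.
Qed.

Lemma laurent_coefM_zsum (f g : laurent A) n :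
  (f * g) n = zsum (fun i => f i * g (n - i)).
Proof. by []. Qed.

(** Indexing by the exponent taken from the right factor lets f g and g f be compared summand by
    summand. *)
Lemma laurent_coefM_zsumr (f g : laurent A) n :
  (g * f) n = zsum (fun i => g (n - i) * f i).
Proof.
rewrite laurent_coefM_zsum /zsum.
rewrite (@reindex_fsbigT _ _ _ _ _ (fun i : int => n - i)).
  by apply: eq_fsbigr => i _; rewrite subKr.
by exists (fun i => n - i) => i; rewrite subKr.
Qed.

Lemma laurent_mul_fs (f g : laurent A) n :
  finitely_supported (fun i => f i * g (n - i)).
Proof.
have [[N fN] [M gM]] := (laurent_bounded f, laurent_bounded g).
apply: (@fs_between _ N (n - M)) => i iN; first by rewrite fN ?mul0r.
by rewrite gM ?mulr0 //; lia.
Qed.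

Lemma laurent_mulr_fs (f g : laurent A) n :
  finitely_supported (fun i => g (n - i) * f i).
Proof.
have [[N fN] [M gM]] := (laurent_bounded f, laurent_bounded g).
apply: (@fs_between _ N (n - M)) => i iN; first by rewrite fN ?mulr0.
by rewrite gM ?mul0r //; lia.
Qed.

End BilateralSum.

Section Quadratic.
Variables (K : pzRingType) (A : pzAlgType K).

(* (w - Q z) f(z) g(w) = (Q w - z) g(w) f(z) for f(z) = \sum_r f r z^r and
   g(w) = \sum_r g r w^r *)
Definition quad_rel (Q : K) (f g : int -> A) := forall r r',
  f (r + 1) * g r' + g (r' + 1) * f r =
  scal Q * (f r * g (r' + 1) + g r' * f (r + 1)).

Lemma quad_relD Q f1 f2 g : quad_rel Q f1 g -> quad_rel Q f2 g ->
  quad_rel Q (fun r => f1 r + f2 r) g.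
Proof.
move=> q1 q2 r r'; rewrite !mulrDl !mulrDr addrACA q1 q2 -mulrDr.
by rewrite !mulrDr addrACA.
Qed.

Lemma quad_relDr Q f g1 g2 : quad_rel Q f g1 -> quad_rel Q f g2 ->
  quad_rel Q f (fun r => g1 r + g2 r).
Proof.
move=> q1 q2 r r'; rewrite !mulrDl !mulrDr addrACA q1 q2 -mulrDr.
by rewrite !mulrDr addrACA.
Qed.

Lemma quad_relC Q f g : quad_rel Q f g -> quad_rel Q g f.
Proof. by move=> q r r'; rewrite addrC q addrC. Qed.

Lemma quad_rel_eq Q f f' g g' : f =1 f' -> g =1 g' -> quad_rel Q f g ->
  quad_rel Q f' g'.
Proof. by move=> ff gg q r r'; rewrite -!ff -!gg. Qed.

End Quadratic.

(* An abstract stand-in for (a, b) |-> a ⊗ b : tens A A, which keeps unification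
   from unfolding the quotient construction of tens. *)
Record tensor_map (K : pzRingType) (A V : pzAlgType K) (p : A -> A -> V) :=
  TensorMap {
  tens11 : p 1 1 = 1;
  tensM : forall a a' b b', p a b * p a' b' = p (a * a') (b * b');
  tensDl : forall a a' b, p (a + a') b = p a b + p a' b;
  tensDr : forall a b b', p a (b + b') = p a b + p a b';
  tensZl : forall c a b, p (scal c * a) b = scal c * p a b;
  tensZr : forall c a b, p a (scal c * b) = scal c * p a b
}.

Section TensorMap.
Variables (K : pzRingType) (A V : pzAlgType K) (p : A -> A -> V).
Hypothesis pP : tensor_map p.

Lemma tens0l b : p 0 b = 0.
Proof. by apply: (addrI (p 0 b)); rewrite -(tensDl pP) !addr0. Qed.

Lemma tens0r a : p a 0 = 0.
Proof. by apply: (addrI (p a 0)); rewrite -(tensDr pP) !addr0. Qed.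

Lemma tensNl a b : p (- a) b = - p a b.
Proof. by apply: (addrI (p a b)); rewrite -(tensDl pP) !subrr tens0l. Qed.

Lemma tensNr a b : p a (- b) = - p a b.
Proof. by apply: (addrI (p a b)); rewrite -(tensDr pP) !subrr tens0r. Qed.

End TensorMap.

(** * Series of the form f(z) ⊗ g(u z) *)

Section Convolution.
Variables (K : pzRingType) (A V : pzAlgType K) (p : A -> A -> V).
Local Notation "a ⊗ b" := (p a b) : ring_scope.
Local Notation T := (laurent V).
Implicit Types (f g : int -> A) (X Y : int -> T).

(* X(z) = f(z) ⊗ g(u z) *)
Definition is_conv f g X := forall r n, X r n = f (r - n) ⊗ g n.

Hypothesis pP : tensor_map p.
Variables (f g f' g' : int -> A) (X X' : int -> T).
Hypothesis XE : is_conv f g X.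
Hypothesis X'E : is_conv f' g' X'.

Let P r r' n a :=
  (f (r - a) * f' (r' - (n - a))) ⊗ (g a * g' (n - a)).
Let P' r r' n a :=
  (f' (r' - (n - a)) * f (r - a)) ⊗ (g' (n - a) * g a).

Let P_fs r r' n : finitely_supported (P r r' n).
Proof.
have [k Pk] := laurent_mul_fs (X r) (X' r') n; exists k => i /Pk.
by rewrite XE X'E (tensM pP).
Qed.

Let P'_fs r r' n : finitely_supported (P' r r' n).
Proof.
have [k Pk] := laurent_mulr_fs (X r) (X' r') n; exists k => i /Pk.
by rewrite XE X'E (tensM pP).
Qed.

Let PE r r' n : (X r * X' r') n = zsum (P r r' n).
Proof.
by rewrite laurent_coefM_zsum; apply: eq_zsum => a; rewrite XE X'E (tensM pP).
Qed.

Let P'E r r' n : (X' r' * X r) n = zsum (P' r r' n).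
Proof.
by rewrite laurent_coefM_zsumr; apply: eq_zsum => a; rewrite XE X'E (tensM pP).
Qed.

Lemma conv_comm r r' : (forall a b, f a * f' b = f' b * f a) ->
  (forall a b, g a * g' b = g' b * g a) -> X r * X' r' = X' r' * X r.
Proof.
move=> fC gC; apply: laurentP => n; rewrite PE P'E; apply: eq_zsum => a.
by rewrite /P /P' fC gC.
Qed.

Lemma conv_quad_r Q : (forall a b, f a * f' b = f' b * f a) ->
  quad_rel Q g g' -> quad_rel Q X X'.
Proof.
move=> fC q r r'; apply: laurentP => n.
rewrite laurent_coefZ.
transitivity (zsum (P (r + 1) r' n) + zsum (P' r (r' + 1) n)).
  exact: (congr2 +%R (PE _ _ _) (P'E _ _ _)).
transitivity (scal Q * (zsum (P r (r' + 1) n) + zsum (P' (r + 1) r' n))); last first.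
  exact/esym/(congr1 _ (congr2 +%R (PE _ _ _) (P'E _ _ _))).
(* Shifting [a] by one in the two sums with [r + 1] gives all four summands the same left indices
   [r - a] and [r' + 1 - (n - a)], so the relation can be used in the right slot. *)
rewrite [zsum (P (r + 1) r' n)]zsum_shift [zsum (P' (r + 1) r' n)]zsum_shift.
rewrite !zsumD //; do 1?[exact: fs_shift].
rewrite zsumZ; last by apply: fsD => //; exact: fs_shift.
apply: eq_zsum => a; rewrite /P /P'.
have -> : r + 1 - (a + 1) = r - a by lia.
have -> : r' - (n - (a + 1)) = r' + 1 - (n - a) by lia.
rewrite -!fC -!(tensDr pP) -(tensZr pP); congr (_ ⊗ _).
have -> : n - a = n - (a + 1) + 1 by lia.
exact: q.
Qed.

Lemma conv_quad_l Q : (forall a b, g a * g' b = g' b * g a) ->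
  quad_rel Q f f' -> quad_rel Q X X'.
Proof.
move=> gC q r r'; apply: laurentP => n.
rewrite laurent_coefZ.
transitivity (zsum (P (r + 1) r' n) + zsum (P' r (r' + 1) n)).
  exact: (congr2 +%R (PE _ _ _) (P'E _ _ _)).
transitivity (scal Q * (zsum (P r (r' + 1) n) + zsum (P' (r + 1) r' n))); last first.
  exact/esym/(congr1 _ (congr2 +%R (PE _ _ _) (P'E _ _ _))).
rewrite !zsumD // zsumZ; last exact: fsD.
apply: eq_zsum => a; rewrite /P /P'.
rewrite -!gC -!(tensDl pP) -(tensZl pP); congr (_ ⊗ _).
have -> : r + 1 - a = r - a + 1 by lia.
have -> : r' + 1 - (n - a) = r' - (n - a) + 1 by lia.
exact: q.
Qed.

End Convolution.

Section ConvolutionCommute.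
Variables (K : fieldType) (A V : pzAlgType K) (p : A -> A -> V).
Hypothesis pP : tensor_map p.
Local Notation "a ⊗ b" := (p a b) : ring_scope.
Local Notation T := (laurent V).
Variables (f g f' g' : int -> A) (X X' : int -> T).
Hypothesis XE : is_conv p f g X.
Hypothesis X'E : is_conv p f' g' X'.
Variable q : K.
Hypothesis q_neq0 : q != 0.
Hypothesis f0 : forall a, 0 < a -> f a = 0.
Hypothesis g'0 : forall b, b < 0 -> g' b = 0.
Hypothesis qf : quad_rel q f f'.
Hypothesis qg : quad_rel q^-1 g g'.

(* The commutator C r r' of X r and X' r' satisfies C (r + 1) r' = q C r (r' + 1),
   while its coefficients of u^n vanish for n < r. *)
Lemma conv_quad_comm r r' : X r * X' r' = X' r' * X r.
Proof.
(* [N] is the mixed product, with f' f in the left slot and g g' in the right one. It links X X' to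
   X' X by crossing one slot at a time. It is a product in neither order, so its finite support
   comes from the one-sidedness of [f] and [g']. *)
pose N r r' n a := (f' (r' - (n - a)) * f (r - a)) ⊗ (g a * g' (n - a)).
have N_fs s s' n : finitely_supported (N s s' n).
  apply: (@fs_between _ _ _ s n) => a an; rewrite /N.
    by rewrite [f _]f0 ?mulr0 ?(tens0l pP) //; lia.
  by rewrite [g' _]g'0 ?mulr0 ?(tens0r pP) //; lia.
pose P r r' n a := (f (r - a) * f' (r' - (n - a))) ⊗ (g a * g' (n - a)).
pose P' r r' n a := (f' (r' - (n - a)) * f (r - a)) ⊗ (g' (n - a) * g a).
have P_fs s s' n : finitely_supported (P s s' n).
  have [k Pk] := laurent_mul_fs (X s) (X' s') n; exists k => i /Pk.
  by rewrite XE X'E (tensM pP).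
have P'_fs s s' n : finitely_supported (P' s s' n).
  have [k Pk] := laurent_mulr_fs (X s) (X' s') n; exists k => i /Pk.
  by rewrite XE X'E (tensM pP).
have PE s s' n : (X s * X' s') n = zsum (P s s' n).
  by rewrite laurent_coefM_zsum; apply: eq_zsum => a; rewrite XE X'E (tensM pP).
have P'E s s' n : (X' s' * X s) n = zsum (P' s s' n).
  by rewrite laurent_coefM_zsumr; apply: eq_zsum => a; rewrite XE X'E (tensM pP).
have PN s s' n : zsum (P (s + 1) s' n) + zsum (N s (s' + 1) n) =
    scal q * (zsum (P s (s' + 1) n) + zsum (N (s + 1) s' n)).
  rewrite !zsumD // zsumZ; last exact: fsD.
  apply: eq_zsum => a; rewrite /P /N -!(tensDl pP) -(tensZl pP); congr (_ ⊗ _).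
  have -> : s + 1 - a = s - a + 1 by lia.
  have -> : s' + 1 - (n - a) = s' - (n - a) + 1 by lia.
  exact: qf.
have NP s s' n : zsum (N s (s' + 1) n) + zsum (P' (s + 1) s' n) =
    scal q * (zsum (N (s + 1) s' n) + zsum (P' s (s' + 1) n)).
  rewrite [zsum (P' (s + 1) s' n)]zsum_shift [zsum (N (s + 1) s' n)]zsum_shift.
  rewrite !zsumD //; do 1?[exact: fs_shift].
  rewrite zsumZ; last by apply: fsD => //; exact: fs_shift.
  apply: eq_zsum => a; rewrite /P' /N.
  have -> : s + 1 - (a + 1) = s - a by lia.
  have -> : s' - (n - (a + 1)) = s' + 1 - (n - a) by lia.
  rewrite -!(tensDr pP) -(tensZr pP); congr (_ ⊗ _).
  have -> : n - a = n - (a + 1) + 1 by lia.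
  by rewrite qg mulrA -scalM divff // scal1 mul1r.
pose C r r' := X r * X' r' - X' r' * X r.
(* The sums of [N] enter [PN] and [NP] identically and cancel in the difference. *)
have Crec s s' n : C (s + 1) s' n = scal q * C s (s' + 1) n.
  have CE t t' : C t t' n = zsum (P t t' n) - zsum (P' t t' n).
    exact: (congr2 (fun x y => x - y) (PE _ _ _) (P'E _ _ _)).
  rewrite !CE; apply/eqP.
  rewrite mulrBr subr_eq addrAC eq_sym subr_eq eq_sym.
  apply/eqP; apply: (addIr (zsum (N s (s' + 1) n))).
  rewrite addrAC PN mulrDr -!addrA; congr (_ + _).
  by rewrite -mulrDr -NP addrC.
have Csmall s s' n : n < s -> C s s' n = 0.
  move=> ns; have XN i : i < s -> X s i = 0.
    by move=> si; rewrite XE f0 ?(tens0l pP) //; lia.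
  have X'N i : i < 0 -> X' s' i = 0.
    by move=> si; rewrite X'E g'0 ?(tens0r pP) //; lia.
  have e : (X s * X' s') n = 0 by apply: laurent_coefM_small XN X'N _; lia.
  have e' : (X' s' * X s) n = 0 by apply: laurent_coefM_small X'N XN _; lia.
  exact: etrans (congr2 (fun x y => x - y) e e') (subr0 0).
(* Since [q] is invertible, [Crec] can be iterated to raise the first index beyond [n], where
   [Csmall] applies. *)
have C0 (k : nat) n : forall s s', n < s + k%:Z -> C s s' n = 0.
  elim: k => [|k IHk] s s' ns; first by apply: Csmall; lia.
  apply: (scal_mulr_eq0 q_neq0); rewrite -[s'](subrK 1) -Crec; apply: IHk; lia.
apply: subr0_eq; apply: laurentP => n.
apply: etrans (C0 (absz (n - r)%R).+1 n r r' _) (esym (laurent_coef0 _ _)); lia.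
Qed.

End ConvolutionCommute.

(** * Commutation of phi with x *)

Section ExpCommute.
Variables (K : numFieldType) (A : pzAlgType K) (Q : K).
Hypothesis Q_neq0 : Q != 0.

(* (1 - Q^-1 z) / (1 - Q z) = \sum_l quad_coef l z^l *)
Definition quad_coef (l : nat) : K := if l is l'.+1 then Q ^+ l' * (Q - Q^-1) else 1.

(** With G(z) = (1 - Q^-1 z) / (1 - Q z), log G is the sum of (Q^b - Q^-b) z^b / b; this is the
    resulting differential equation for G, coefficient by coefficient. *)
Lemma quad_coef_rec l : quad_coef l.+1 *+ l.+1 =
  \sum_(b < l.+1) (Q ^+ b.+1 - Q ^- b.+1) * quad_coef (l - b).
Proof.
elim: l => [|l IHl]; first by rewrite big_ord1 /= expr0 !expr1 mul1r mulr1.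
have IHl' := IHl; rewrite big_ord_recr /= subnn mulr1 in IHl'.
rewrite !big_ord_recr /= subnn subSnn /= expr0 mul1r mulr1.
(* From index 1 on the coefficients are geometric with ratio [Q], and [l - b] is at least 1 for
   [b < l]. *)
have -> : \sum_(b < l) (Q ^+ b.+1 - Q ^- b.+1) * quad_coef (l.+1 - b) =
   Q * (\sum_(b < l) (Q ^+ b.+1 - Q ^- b.+1) * quad_coef (l - b)).
  rewrite mulr_sumr; apply: eq_bigr => b _.
  have bl := ltn_ord b; rewrite subSn ?(ltnW bl) //.
  case: (l - b)%N (subn_gt0 b l) => [|d _] /=; first by rewrite bl.
  by rewrite [Q ^+ d.+1]exprS; ring.
move/eqP: IHl'; rewrite -subr_eq => /eqP <-.
rewrite [LHS]mulrS [Q ^+ l.+2]exprS [Q ^+ l.+1]exprS.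
rewrite -mulr_natl -[_ * (Q - Q^-1) *+ l.+1]mulr_natl.
move: (l.+1%:R) => N; have Qn0 : Q ^+ l != 0 by rewrite expf_neq0.
by field; rewrite Qn0.
Qed.

Variables (a : nat -> A) (X : int -> A).
Hypothesis aC : forall b c, a b * a c = a c * a b.
Hypothesis aX : forall b r, (a b.+1 * X r - X r * a b.+1) *+ b.+1 =
  scal (Q ^+ b.+1 - Q ^- b.+1) * X (r + b.+1%:Z).

(** By [aX], bracketing with [a b.+1] shifts the index of [X] by [b.+1], up to a scalar;
    exponentiating, conjugation by exp of the series of [a] acts on [X] as (1 - Q^-1 z) / (1 - Q z)
    with z carrying the shift. The proof compares the recursions of both sides in [m]. *)
Lemma expc_conj m r : expc a m * X r =
  \sum_(l < m.+1) scal (quad_coef l) * (X (r + l%:Z) * expc a (m - l)).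
Proof.
have [E0 ES] := expc_rec aC.
elim/ltn_ind: m r => -[|m] IHm r.
  by rewrite big_ord1 E0 mulr1 mul1r scal1 mul1r addr0.
apply: (@pzalg_mulrnI _ _ m); rewrite -mulrnAl ES mulr_suml.
pose t l := scal (quad_coef l) * (X (r + l%:Z) * expc a (m.+1 - l)).
(* The weight [m.+1 - l] will be matched with the recursion for [expc], the weight [l] with the one
   for [quad_coef]. *)
transitivity (\sum_(l < m.+2) (t l *+ (m.+1 - l) + t l *+ l)); last first.
  rewrite -sumrMnl; apply: eq_bigr => l _.
  by rewrite -mulrnDr subnK // -ltnS.
rewrite big_split /= [X in _ = X + _]big_ord_recr /= subnn mulr0n addr0.
rewrite [X in _ = _ + X]big_ord_recl /= mulr0n add0r.
transitivity (\sum_(b < m.+1) \sum_(l < m.+1 | (l + b <= m)%N)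
   (scal (quad_coef l) * (X (r + l%:Z) * a b.+1 * expc a (m - b - l)) *+ b.+1)
  + \sum_(b < m.+1) \sum_(l < m.+1 | (l + b <= m)%N)
      scal (quad_coef l) * (scal (Q ^+ b.+1 - Q ^- b.+1) *
        X (r + (l + b.+1)%:Z) * expc a (m - b - l))).
  rewrite -big_split; apply: eq_bigr => b _; rewrite -big_split /=; have bm := ltn_ord b.
  rewrite -mulrnAl -mulrA IHm; last by lia.
  rewrite mulr_sumr (big_ord_widen m.+1 (fun l => a b.+1 *+ b.+1 *
    (scal (quad_coef l) * (X (r + l%:Z) * expc a (m - b - l))))); last by lia.
  apply: eq_big => [l|l _]; first by lia.
  rewrite scalCA -mulrnAr -mulrDr; congr (_ * _).
  rewrite !mulrA -mulrnAl -mulrDl; congr (_ * _).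
  have := aX b (r + l%:Z); rewrite PoszD addrA => <-.
  by rewrite mulrnAl mulrnBl [RHS]addrC subrK.
congr (_ + _).
  rewrite (exchange_big_dep xpredT) //=; apply: eq_bigr => l _.
  have lm := ltn_ord l; rewrite /t -mulrnAr subSn ?ltnS // -mulrnAr ES !mulr_sumr.
  rewrite (big_ord_widen m.+1 (fun b => scal (quad_coef l) * (X (r + l%:Z) *
    (a b.+1 * expc a (m - l - b) *+ b.+1)))); last by lia.
  apply: eq_big => [b|b _]; first by lia.
  by rewrite !mulrnAr !mulrA subnAC.
(* The bracket terms are collected according to [n = l + b], the total shift being [n.+1]. *)
transitivity (\sum_(n < m.+1) \sum_(b < m.+1 | (b <= n)%N)
   scal ((Q ^+ b.+1 - Q ^- b.+1) * quad_coef (n - b)) *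
   (X (r + n.+1%:Z) * expc a (m - n))).
  rewrite [RHS](exchange_big_dep xpredT) //=; apply: eq_bigr => b _.
  have bm := ltn_ord b.
  rewrite -[RHS](big_mkord (fun n => (b <= n)%N) (fun n =>
    scal ((Q ^+ b.+1 - Q ^- b.+1) * quad_coef (n - b)) *
    (X (r + n.+1%:Z) * expc a (m - n)))).
  rewrite (big_cat_nat _ (n := b)) ?(ltnW bm) //= [X in _ = X + _]big_nat_cond.
  rewrite [X in _ = X + _]big1 ?add0r; last first.
    by move=> n /andP[/andP[_ nb]]; rewrite leqNgt nb.
  rewrite -[X in index_iota X _]add0n big_addn subSn // big_mkord.
  rewrite (big_ord_widen_cond m.+1 (fun i => b <= i + b)%N (fun i =>
    scal ((Q ^+ b.+1 - Q ^- b.+1) * quad_coef (i + b - b)) *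
    (X (r + (i + b).+1%:Z) * expc a (m - (i + b))))); last by lia.
  apply: eq_big => [l|l _]; first by rewrite leq_addl /=; lia.
  by rewrite addnK scalM -!mulrA scalCA addnS [(l + b)%N]addnC subnDA.
apply: eq_bigr => n _; rewrite /t /bump add1n subSS -mulr_suml.
rewrite -mulrnAl -scalMn quad_coef_rec.
rewrite (big_ord_widen m.+1 (fun b =>
  (Q ^+ b.+1 - Q ^- b.+1) * quad_coef (n - b))); last exact: ltn_ord.
by rewrite (big_morph scal (@scalD _ A) (scal0 A)).
Qed.

Variables (k0 : A).
Hypothesis k0X : forall r, k0 * X r = scal Q * (X r * k0).
Hypothesis k0a : forall b, k0 * a b = a b * k0.

(** This is [expc_conj] with the denominator 1 - Q z cleared; the factor [k0] supplies the remaining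
    power of [Q]. *)
Lemma expc_quad_rel (phi : int -> A) :
  (forall m, phi m = if 0 <= m then k0 * expc a `|m| else 0) ->
  quad_rel Q phi X.
Proof.
move=> phiE m r.
have kE n : expc a n * k0 = k0 * expc a n.
  by apply: expc_comm => b; rewrite k0a.
(* At [m = -1] the relation is the one between [k0] and [X]; below that every term vanishes. *)
have [m0|m0] := ltP m 0.
  rewrite [phi m]phiE leNgt m0 mulr0 mul0r add0r addr0.
  rewrite phiE; case: ifP => m1; last by rewrite mul0r !mulr0.
  have -> : m + 1 = 0 by lia.
  by rewrite expc0 mulr1 k0X.
case: m m0 => // m _; rewrite !phiE /= addn1.
have kX n r' : k0 * expc a n * X r' = scal Q * (expc a n * X r' * k0).
  by rewrite -kE -mulrA k0X scalCA !mulrA.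
have Xk n r' : X r' * (k0 * expc a n) = X r' * expc a n * k0.
  by rewrite -kE mulrA.
rewrite !kX !Xk.
(* With S the shift of the index of X, this is the coefficient form of (1 - Q z S) E X = (1 - Q^-1 z
   S) X E; expanding by [expc_conj], the geometric tails agree. *)
have main : expc a m.+1 * X r + scal Q^-1 * (X (r + 1) * expc a m) =
    scal Q * (expc a m * X (r + 1)) + X r * expc a m.+1.
  rewrite [expc a m.+1 * X r]expc_conj [expc a m * _]expc_conj.
  rewrite [in LHS]big_ord_recl scal1 mul1r addr0 subn0.
  rewrite -addrA [RHS]addrC; congr (_ + _).
  under eq_bigr do rewrite lift0 subSS.
  rewrite big_ord_recl [in RHS]big_ord_recl subn0.
  rewrite addrAC [RHS]mulrDr [X in _ = _ + X]mulr_sumr; congr (_ + _).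
    by rewrite scal1 mul1r addr0 /= expr0 mul1r -mulrDl -scalD subrK.
  apply: eq_bigr => l _; rewrite !lift0 [RHS]mulrA -scalM /= exprS !mulrA.
  congr (_ * X _ * _); lia.
transitivity (scal Q *
    ((expc a m.+1 * X r + scal Q^-1 * (X (r + 1) * expc a m)) * k0)).
  rewrite mulrDl mulrDr; congr (_ + _).
  by rewrite -[scal Q^-1 * _ * _]mulrA [RHS]mulrA -scalM divff // scal1 mul1r.
by rewrite main mulrDl -[scal Q * _ * k0]mulrA.
Qed.

End ExpCommute.

Lemma comm_add (A : pzRingType) (x y x' y' : A) : x * x' = x' * x -> y * y' = y' * y ->
  (x + y) * (x' + y') - (x' + y') * (x + y) =
  (x * y' - y' * x) + (y * x' - x' * y).
Proof.
move=> xx yy; rewrite !mulrDl !mulrDr xx yy.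
rewrite [X in X + _ - _]addrC [X in _ - (X + _)]addrC.
rewrite [X in X - _ = _]addrACA [X in _ - X = _]addrACA opprD [LHS]addrACA.
by rewrite subrr addr0 [_ + y' * x]addrC opprD addrACA.
Qed.

Lemma scalM_ACA (K : pzRingType) (A : pzAlgType K) (c d : K) (x y : A) :
  (scal c * x) * (scal d * y) = scal (c * d) * (x * y).
Proof. by rewrite scalM -!mulrA (scalCA d). Qed.

Lemma scal_comm (K : comPzRingType) (A : pzAlgType K) (c d : K) (x y : A) :
  x * y = y * x -> (scal c * x) * (scal d * y) = (scal d * y) * (scal c * x).
Proof. by move=> xy; rewrite !scalM_ACA xy mulrC. Qed.

Lemma sgbK s (m : int) : sgb s * (sgb s * m) = m.
Proof. by case: s; rewrite ?mul1r // !mulN1r opprK. Qed.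

(** * Families satisfying the defining relations in an arbitrary algebra *)

Section AffineData.
Variables (K : numFieldType) (D : realized_gcm) (q : K) (qp : rat -> K).
Local Notation I := 'I_(gcm_rank D).
Local Notation H := (cartan_space D).

Section Definitions.
Variables (U : pzAlgType K) (x : bool -> I -> int -> U) (k : H -> U).
Variable h : I -> int -> U.

Definition cartan_shift (s : bool) (i : I) : H :=
  ((sgb s)%:~R * (gcm_sym i)%:R) *: simple_coroot i.

Definition phi_exponent (s : bool) (i : I) (b : nat) : U :=
  scal ((sgb s)%:~R * (q - q^-1)) * h i (sgb s * b%:Z).

Definition phi_data (s : bool) (i : I) (m : int) : U :=
  if 0 <= sgb s * m then k (cartan_shift s i) * expc (phi_exponent s i) `|m| else 0.

Definition quantum_int (m : int) : K := (q ^ m - q ^ (- m)) / (q - q^-1).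

(** The relations of [affine_rel], with [h] extended by 0 to the index 0 and the quadratic relation
    in the symmetric form [quad_rel]. Each such family is the image of the generators under a
    morphism, by [Uaff_lift]. *)
Record affine_data := AffineData {
  data_kk : forall h1 h2, k h1 * k h2 = k (h1 + h2);
  data_k0 : k 0 = 1;
  data_h0 : forall i, h i 0 = 0;
  data_kh : forall h1 j m, k h1 * h j m = h j m * k h1;
  data_hh : forall i m j m', h i m * h j m' = h j m' * h i m;
  data_kx : forall h1 s j r, k h1 * x s j r * k (- h1) =
    scal (qp ((sgb s)%:~R * simple_root j h1)) * x s j r;
  data_hx : forall i m s j r, m != 0 ->
    h i m * x s j r - x s j r * h i m =
    scal ((sgb s)%:~R * m%:~R^-1 * quantum_int (m * symB i j)) * x s j (m + r);
  data_xx : forall i r j r',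
    x true i r * x false j r' - x false j r' * x true i r =
    if i == j then
      scal (q ^+ gcm_sym i - (q ^+ gcm_sym i)^-1)^-1 *
      (phi_data true i (r + r') - phi_data false i (r + r'))
    else 0;
  data_quad : forall s i j, quad_rel (q ^ (sgb s * symB i j)) (x s i) (x s j)
}.

End Definitions.

Lemma phi_data_small (U : pzAlgType K) (k : H -> U) h s i m :
  sgb s * m < 0 -> phi_data k h s i m = 0.
Proof. by move=> sm; rewrite /phi_data leNgt sm. Qed.

Hypothesis q_neq0 : q != 0.
Hypothesis q_sqr : q - q^-1 != 0.
Hypothesis qp_int : forall z : int, qp z%:~R = q ^ z.

(** The factor q - q^-1 of [phi_exponent] cancels the denominator of the quantum integer, and [b.+1]
    cancels the 1/m of the bracket of h with x; the result is the scalar required in hypothesis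
    [aX]. *)
Lemma quantum_int_sgb s t (B : int) b :
  (sgb t)%:~R * (q - q^-1) *
    ((sgb s)%:~R / (sgb t * b.+1%:Z)%:~R * quantum_int (sgb t * b.+1%:Z * B)) *+ b.+1 =
  (q ^ (sgb t * (sgb s * B))) ^+ b.+1 - (q ^ (sgb t * (sgb s * B))) ^- b.+1.
Proof.
pose P := q ^ (b.+1%:Z * B).
have QE : (q ^ (sgb t * (sgb s * B))) ^+ b.+1 - (q ^ (sgb t * (sgb s * B))) ^- b.+1 =
    (sgb t * sgb s)%:~R * (P - P^-1).
  rewrite !exprnP !exprz_exp !invr_expz /P.
  by case: s; case: t; rewrite /= ?mul1r ?mulN1r ?opprK ?mulNr ?invr_expz ?opprK
    [_ * B]mulrC //= ?opprB.
have qE : quantum_int (sgb t * b.+1%:Z * B) = (sgb t)%:~R * (P - P^-1) / (q - q^-1).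
  rewrite /quantum_int /P -mulrA invr_expz; case: t {QE} => /=.
    by rewrite !mul1r.
  by rewrite rmorphN1 !mulN1r mulNr opprK -mulNr opprB.
have b0 : b.+1%:R != 0 :> K by rewrite pnatr_eq0.
rewrite QE qE !intrM -mulr_natr -[(Posz b.+1)%:~R]pmulrn.
move: (b.+1%:R) (P - P^-1) (q - q^-1) b0 q_sqr => N p d N0 d0.
have sgb_cases u : (sgb u)%:~R = 1 :> K \/ (sgb u)%:~R = -1 :> K.
  by case: u; [left | right].
by case: (sgb_cases s) => ->; case: (sgb_cases t) => ->; field; rewrite ?N0 ?d0.
Qed.

Section Consequences.
Variables (U : pzAlgType K) (x : bool -> I -> int -> U) (k : H -> U).
Variable h : I -> int -> U.
Hypothesis dataP : affine_data x k h.

Local Notation a := (phi_exponent h).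
Local Notation phi := (phi_data k h).

Lemma phi_exponentC s i t j b c : a s i b * a t j c = a t j c * a s i b.
Proof.
by rewrite /phi_exponent; apply: scal_comm; exact: data_hh dataP _ _ _ _.
Qed.

Lemma k_comm h1 h2 : k h1 * k h2 = k h2 * k h1.
Proof. by rewrite !(data_kk dataP) addrC. Qed.

Lemma kN_mul h1 : k (- h1) * k h1 = 1.
Proof. by rewrite (data_kk dataP) addNr (data_k0 dataP). Qed.

Lemma phi_data_comm s i m y : (forall h1, k h1 * y = y * k h1) ->
  (forall j l, h j l * y = y * h j l) -> phi s i m * y = y * phi s i m.
Proof.
move=> ky hy; rewrite /phi_data; case: ifP => _; last by rewrite mul0r mulr0.
rewrite mulrA -ky -!mulrA; congr (_ * _); apply: expc_comm => b.
by rewrite /phi_exponent -mulrA hy !mulrA scalC.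
Qed.

Lemma phi_data_k s i m h1 : phi s i m * k h1 = k h1 * phi s i m.
Proof.
apply: phi_data_comm => [h2|j l]; first exact: k_comm.
by rewrite (data_kh dataP).
Qed.

Lemma phi_data_h s i m j l : phi s i m * h j l = h j l * phi s i m.
Proof.
apply: phi_data_comm => [h2|j' l']; first by rewrite (data_kh dataP).
exact: data_hh dataP _ _ _ _.
Qed.

Lemma phi_dataC s i m t j l : phi s i m * phi t j l = phi t j l * phi s i m.
Proof. by apply: phi_data_comm => *; rewrite ?phi_data_k ?phi_data_h. Qed.

(** The factor [gcm_sym i] in [cartan_shift] turns C_ij into B_ij, so the relation between k and x
    gives the scalar [Q] demanded of [k0] in [expc_quad_rel]. *)
Lemma qp_shift t i s j :
  qp ((sgb s)%:~R * simple_root j (cartan_shift t i)) =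
  q ^ (sgb t * (sgb s * symB i j)).
Proof.
rewrite linearZ /= simple_root_coroot -qp_int /symB; congr qp.
rewrite !rmorphM /= -[_ *: _]/(_ * _) pmulrn; ring.
Qed.

Lemma data_hxE i m s j r :
  h i m * x s j r - x s j r * h i m =
  scal ((sgb s)%:~R * m%:~R^-1 * quantum_int (m * symB i j)) * x s j (m + r).
Proof.
have [->|m0] := eqVneq m 0; last exact: (data_hx dataP).
rewrite (data_h0 dataP) mul0r mulr0 subr0 [_ / _]mulrC invr0 !mul0r.
by rewrite scal0 mul0r.
Qed.

(** Substituting z^-1 and w^-1 into the relation, clearing denominators and dividing by -Q
    reproduces its shape with Q^-1. *)
Lemma quad_rel_opp (Q : K) (f g : int -> U) : Q != 0 -> quad_rel Q f g ->
  quad_rel Q^-1 (fun r => f (- r)) (fun r => g (- r)).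
Proof.
move=> Q0 fg r r'.
have := fg (- r - 1) (- r' - 1); rewrite !subrK -!opprD => fgE.
have -> : f (- r) * g (- (r' + 1)) + g (- r') * f (- (r + 1)) =
   scal Q * (f (- (r + 1)) * g (- r') + g (- (r' + 1)) * f (- r)) by [].
by rewrite mulrA -scalM mulVf // scal1 mul1r.
Qed.

Lemma phi_quad t i s j : quad_rel (q ^ (sgb s * symB i j)) (phi t i) (x s j).
Proof.
pose Q := q ^ (sgb t * (sgb s * symB i j)).
have Q0 : Q != 0 by rewrite expfz_neq0.
(* The series phi^- lives in nonpositive degrees; multiplying indices by [sgb t] makes both signs
   instances of [expc_quad_rel], and [quad_rel_opp] undoes the reversal. *)
suff quadt : quad_rel Q (fun m => phi t i (sgb t * m)) (fun r => x s j (sgb t * r)).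
  case: t @Q Q0 quadt => Q Q0 quadt.
    rewrite /Q mul1r in quadt; apply: quad_rel_eq quadt => r; by rewrite mul1r.
  have := quad_rel_opp Q0 quadt; rewrite /Q invr_expz mulN1r opprK.
  by apply: quad_rel_eq => r; rewrite mulN1r opprK.
apply: (@expc_quad_rel _ _ Q Q0 (a t i) (fun r => x s j (sgb t * r)) _ _
  (k (cartan_shift t i))).
- by move=> b c; exact: phi_exponentC.
- move=> b r; rewrite /phi_exponent -mulrA scalCA -mulrBr data_hxE.
  rewrite mulrA -scalM -mulrnAl -scalMn.
  have -> : sgb t * b.+1 + sgb t * r = sgb t * (r + b.+1) by rewrite mulrDr addrC.
  congr (scal _ * _); exact: quantum_int_sgb.
- move=> r.
  rewrite -[LHS]mulr1 -(kN_mul (cartan_shift t i)) mulrA (data_kx dataP).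
  by rewrite qp_shift -[LHS]mulrA.
- by move=> b; rewrite /phi_exponent scalCA -[RHS]mulrA (data_kh dataP).
- move=> m; rewrite /phi_data sgbK; case: ifP => // m0.
  by congr (_ * expc _ _); rewrite abszM; case: (t); rewrite mul1n.
Qed.

End Consequences.

End AffineData.

(** * The coproduct of the generators *)

Section LaurentTensor.
Variables (K : pzRingType) (A V : pzAlgType K) (p : A -> A -> V).
Hypothesis pP : tensor_map p.
Local Notation "a ⊗ b" := (p a b) : ring_scope.
Local Notation T := (laurent V).

Lemma laurent_scalE (c : K) : scal c = laurent_mono 0 (scal c) :> T.
Proof. by []. Qed.

Lemma laurent_monoZ (c : K) j (t : V) :
  scal c * laurent_mono j t = laurent_mono j (scal c * t).
Proof. by rewrite laurent_scalE laurent_monoM add0r. Qed.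

Lemma tens_scalE (c : K) : scal c = scal c ⊗ 1 :> V.
Proof. by rewrite -[scal c in RHS]mulr1 (tensZl pP) (tens11 pP) mulr1. Qed.

Lemma tens_scalEr (c : K) : scal c = 1 ⊗ scal c :> V.
Proof. by rewrite -[scal c in RHS]mulr1 (tensZr pP) (tens11 pP) mulr1. Qed.

Lemma laurent_tensl_morphism :
  alg_morphism (fun a : A => laurent_mono 0 (a ⊗ 1) : T).
Proof.
split=> [a b|a b|c].
- by rewrite -laurent_monoD (tensDl pP).
- by rewrite laurent_monoM addr0 (tensM pP) mulr1.
- by rewrite laurent_scalE tens_scalE.
Qed.

Lemma laurent_tensr_morphism :
  alg_morphism (fun a : A => laurent_mono 0 (1 ⊗ a) : T).
Proof.
split=> [a b|a b|c].
- by rewrite -laurent_monoD (tensDr pP).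
- by rewrite laurent_monoM addr0 (tensM pP) mulr1.
- by rewrite laurent_scalE tens_scalEr.
Qed.

Lemma laurent_mono_tensM j l a b a' b' :
  (laurent_mono j (a ⊗ b) : T) * laurent_mono l (a' ⊗ b') =
  laurent_mono (j + l) ((a * a') ⊗ (b * b')).
Proof. by rewrite laurent_monoM (tensM pP). Qed.

(* The coefficients of the series 1, which makes x(z) ⊗ 1 and 1 ⊗ x(u z) instances
   of is_conv. *)
Definition int_delta (n : int) : A := (n == 0)%:R.

Lemma int_delta_comm n y : int_delta n * y = y * int_delta n.
Proof. by rewrite /int_delta; case: (n == 0); rewrite ?mulr1 ?mul1r ?mulr0 ?mul0r. Qed.

Lemma conv_mono_l (f : int -> A) :
  is_conv p f int_delta (fun r => laurent_mono 0 (f r ⊗ 1)).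
Proof.
move=> r n /=; rewrite /int_delta; case: eqP => [->|_]; first by rewrite subr0.
by rewrite (tens0r pP).
Qed.

Lemma conv_mono_r (f : int -> A) :
  is_conv p int_delta f (fun r => laurent_mono r (1 ⊗ f r)).
Proof.
move=> r n /=; rewrite /int_delta subr_eq0 eq_sym; case: eqP => [->|_] //.
by rewrite (tens0l pP).
Qed.

(** The one-sidedness of [f] makes [f (r - n) ⊗ g n] vanish for [n < r], exactly where the series
    has no term. *)
Lemma conv_series_l (f g : int -> A) : (forall m, 0 < m -> f m = 0) ->
  is_conv p f g (fun r => laurent_series r (fun l => f (- l%:Z) ⊗ g (r + l%:Z))).
Proof.
move=> f0 r n /=; have [rn|nr] := leP r n.
  by congr (f _ ⊗ g _); lia.
by rewrite f0 ?(tens0l pP) //; lia.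
Qed.

Lemma conv_series_r (f g : int -> A) : (forall m, m < 0 -> g m = 0) ->
  is_conv p f g (fun r => laurent_series 0 (fun l => f (r - l%:Z) ⊗ g l%:Z)).
Proof.
move=> g0 r n /=; have [n0|n0] := leP 0 n.
  by congr (f _ ⊗ g _); lia.
by rewrite g0 ?(tens0r pP) //; lia.
Qed.

Variables (f g : int -> A) (X : int -> T).
Hypothesis XE : is_conv p f g X.

Lemma conv_conj k k' (c d : K) r :
  (forall a, k * f a * k' = scal c * f a) ->
  (forall a, k * g a * k' = scal d * g a) ->
  laurent_mono 0 (k ⊗ k) * X r * laurent_mono 0 (k' ⊗ k') = scal (c * d) * X r.
Proof.
move=> fk gk; apply: laurentP => n.
rewrite laurent_coefM_mono laurent_mono_coefM laurent_coefZ !subr0 XE.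
by rewrite 2!(tensM pP) fk gk (tensZl pP) (tensZr pP) mulrA scalM.
Qed.

(** Bracketing with y ⊗ 1 raises the index of [f] at fixed exponent of u; bracketing with u^m (1 ⊗
    y) raises the index of [g] and the exponent together. Both land in [X (m + r)]. *)
Lemma conv_bracket y m (c d : K) r :
  (forall a, y * f a - f a * y = scal c * f (m + a)) ->
  (forall a, y * g a - g a * y = scal d * g (m + a)) ->
  (laurent_mono 0 (y ⊗ 1) + laurent_mono m (1 ⊗ y)) * X r -
    X r * (laurent_mono 0 (y ⊗ 1) + laurent_mono m (1 ⊗ y)) =
  scal (c + d) * X (m + r).
Proof.
move=> yf yg; rewrite mulrDl mulrDr opprD addrACA scalD mulrDl.
congr (_ + _); apply: laurentP => n.
  rewrite laurent_coefB laurent_coefM_mono laurent_mono_coefM laurent_coefZ.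
  rewrite subr0 !XE 2!(tensM pP) mul1r mulr1 -(tensZl pP) -addrA -yf.
  by rewrite -mulN1r -scal1 -scalN -(tensZl pP) -(tensDl pP) scalN scal1 mulN1r.
rewrite laurent_coefB laurent_coefM_mono laurent_mono_coefM laurent_coefZ.
rewrite !XE 2!(tensM pP) mul1r mulr1 -(tensZr pP).
have -> : r - (n - m) = m + r - n by lia.
have -> : g n = g (m + (n - m)) by congr g; lia.
rewrite -yg.
by rewrite -mulN1r -scal1 -scalN -(tensZr pP) -(tensDr pP) scalN scal1 mulN1r.
Qed.

End LaurentTensor.

(** * The defining relations for the images of the generators *)

Section TensorData.
Variables (K : numFieldType) (D : realized_gcm) (q : K) (qp : rat -> K).
Local Notation I := 'I_(gcm_rank D).
Local Notation H := (cartan_space D).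
Hypothesis q_neq0 : q != 0.
Hypothesis q_sqr : q - q^-1 != 0.
Hypothesis qp_int : forall z : int, qp z%:~R = q ^ z.

Variables (U V : pzAlgType K) (p : U -> U -> V).
Hypothesis pP : tensor_map p.
Local Notation "a ⊗ b" := (p a b) : ring_scope.
Local Notation T := (laurent V).

Variables (x : bool -> I -> int -> U) (k : H -> U) (h : I -> int -> U).
Hypothesis dataP : affine_data q qp x k h.

Local Notation a := (phi_exponent q h).
Local Notation phi := (phi_data q k h).

Definition tens_k h1 : T := laurent_mono 0 (k h1 ⊗ k h1).

Definition tens_h i m : T := laurent_mono 0 (h i m ⊗ 1) + laurent_mono m (1 ⊗ h i m).

(** The summands of the image of x are kept apart because each is a single series f(z) ⊗ g(u z), as
    [conv_x1] and [conv_x2] record. *)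
Definition tens_x1 (s : bool) i r : T :=
  if s then laurent_mono 0 (x true i r ⊗ 1) else laurent_mono r (1 ⊗ x false i r).

Definition tens_x2 (s : bool) i r : T :=
  if s then laurent_series r (fun l => phi false i (- l%:Z) ⊗ x true i (r + l%:Z))
  else laurent_series 0 (fun l => x false i (r - l%:Z) ⊗ phi true i l%:Z).

Definition tens_x s i r : T := tens_x1 s i r + tens_x2 s i r.

Lemma phi_neg_gt0 i m : 0 < m -> phi false i m = 0.
Proof. by move=> m0; apply: phi_data_small; rewrite mulN1r oppr_lt0. Qed.

Lemma phi_pos_lt0 i m : m < 0 -> phi true i m = 0.
Proof. by move=> m0; apply: phi_data_small; rewrite mul1r. Qed.

Lemma conv_x1 s i : is_conv p (if s then x true i else int_delta U)
  (if s then int_delta U else x false i) (tens_x1 s i).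
Proof. by case: s; [exact: conv_mono_l | exact: conv_mono_r]. Qed.

Lemma conv_x2 s i : is_conv p (if s then phi false i else x false i)
  (if s then x true i else phi true i) (tens_x2 s i).
Proof.
case: s; first by apply: conv_series_l => // m; exact: phi_neg_gt0.
by apply: conv_series_r => // m; exact: phi_pos_lt0.
Qed.

Lemma tens_exponentE s i b : phi_exponent q tens_h s i b =
  laurent_mono 0 (a s i b ⊗ 1) + laurent_mono (sgb s * b%:Z) (1 ⊗ a s i b).
Proof.
by rewrite /phi_exponent /tens_h mulrDr !laurent_monoZ (tensZl pP) (tensZr pP).
Qed.

(** The exponent is a sum of two commuting families, so the exponential factors by [expcD]; the
    powers of u come out of the second factor by [expc_grade], and [expc_morph] moves each
    exponential into its own tensor slot. *)
Lemma tens_phi_sum s i (m : nat) :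
  phi_data q tens_k tens_h s i (sgb s * m%:Z) =
  \sum_(l < m.+1) laurent_mono (sgb s * l%:Z)
    (phi s i (sgb s * (m%:Z - l%:Z)) ⊗ phi s i (sgb s * l%:Z)) :> T.
Proof.
pose E := expc (a s i); pose k0 := k (cartan_shift s i).
have sgb_abs (l : nat) : absz (sgb s * l%:Z) = l.
  by rewrite abszM; case: (s); rewrite mul1n.
have phiE (l : nat) : phi s i (sgb s * l%:Z) = k0 * E l.
  by rewrite /phi_data sgbK sgb_abs.
rewrite [LHS]/phi_data sgbK sgb_abs /=.
pose al b : T := laurent_mono 0 (a s i b ⊗ 1).
pose ar b : T := laurent_mono 0 (1 ⊗ a s i b).
(* [t b] is the central power of u with exponent b or -b, according to the sign. *)
pose t (b : nat) : T := laurent_mono (sgb s * b%:Z) 1.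
have tC b y : t b * laurent_mono 0 y = laurent_mono 0 y * t b.
  by rewrite /t !laurent_monoM addr0 add0r mulr1 mul1r.
have ttC b c : t b * t c = t c * t b by rewrite /t !laurent_monoM addrC.
have aC b c : a s i b * a s i c = a s i c * a s i b by exact: (phi_exponentC dataP).
have arC b c : ar b * ar c = ar c * ar b.
  by rewrite /ar !(laurent_mono_tensM pP) aC.
rewrite (@eq_expc _ T _ (fun b => al b + t b * ar b)); last first.
  by move=> b; rewrite tens_exponentE laurent_monoM mul1r addr0.
rewrite expcD; last 3 first.
- by move=> b c; rewrite /al !(laurent_mono_tensM pP) aC.
- move=> b c; rewrite -!mulrA [ar b * _]mulrA -tC [ar c * (t b * _)]mulrA -tC.
  by rewrite -/(ar b) -/(ar c) -!mulrA arC [LHS]mulrA [RHS]mulrA ttC.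
- move=> b c; rewrite mulrA -tC -!mulrA; congr (_ * _).
  by rewrite /al /ar !(laurent_mono_tensM pP) !mulr1 !mul1r.
rewrite mulr_sumr; apply: eq_bigr => l _.
have lm : (l <= m)%N by rewrite -ltnS.
rewrite expc_grade //; last 3 first.
- by move=> b c; rewrite tC.
- by rewrite /t mulr0.
- by move=> b c; rewrite /t laurent_monoM mulr1 PoszD mulrDr.
rewrite -(expc_morph _ _ (laurent_tensl_morphism pP)).
rewrite -(expc_morph _ _ (laurent_tensr_morphism pP)).
rewrite subzn // !phiE /tens_k /t !laurent_monoM !addr0 add0r mul1r.
by rewrite !(tensM pP) mulr1 mul1r add0r.
Qed.

(** The finite sum of [tens_phi_sum] already contains every nonzero term of phi(z) ⊗ phi(u z):
    outside its range one of the two indices has the wrong sign. *)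
Lemma tens_phi_conv s i :
  is_conv p (phi s i) (phi s i) (phi_data q tens_k tens_h s i).
Proof.
move=> m n; have [sm|sm] := ltP (sgb s * m) 0.
  rewrite [phi_data _ _ _ _ _ _]phi_data_small // laurent_coef0.
  have [sn|sn] := ltP (sgb s * n) 0.
    by rewrite (phi_data_small q k h i sn) (tens0r pP).
  by rewrite phi_data_small ?(tens0l pP) // mulrBr; lia.
rewrite -{1}(sgbK s m); move: (sgb s * m) sm (sgbK s m) => m' m'0 mE.
case: m' m'0 mE => // m' _ mE; rewrite tens_phi_sum laurent_coef_sum /=.
have [sn|sn] := ltP (sgb s * n) 0.
  rewrite [phi s i n]phi_data_small // (tens0r pP) big1 // => l _.
  by case: eqP => // nE; move: sn; rewrite nE sgbK.
have [n' nE] : exists n' : nat, n = sgb s * n'%:Z.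
  by exists (absz (sgb s * n)%R); rewrite gez0_abs // sgbK.
have eqn (l : nat) : (n == sgb s * l%:Z) = (l == n').
  rewrite nE; apply/eqP/eqP => [/(congr1 ( *%R (sgb s)))|-> //].
  by rewrite !sgbK => -[].
under eq_bigr do rewrite eqn; rewrite -mE.
have -> : sgb s * m' - n = sgb s * (m'%:Z - n'%:Z) by rewrite nE mulrBr.
have [nm|mn] := leqP n' m'.
  rewrite (bigD1 (inord n' : 'I_m'.+1)) //= inordK ?eqxx // big1 ?addr0 ?nE // => l.
  by rewrite -val_eqE /= inordK // => /negbTE ->.
(* For [n' > m'] no summand has exponent [n], and the left slot vanishes as well. *)
rewrite [phi s i (sgb s * (_ - _))]phi_data_small ?(tens0l pP).
  by apply: big1 => l _; rewrite ifF //; have := ltn_ord l; lia.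
by rewrite sgbK; lia.
Qed.

Lemma tens_h_comm i m y : (forall j l, h j l * y = y * h j l) ->
  tens_h i m * laurent_mono 0 (y ⊗ y) = laurent_mono 0 (y ⊗ y) * tens_h i m.
Proof.
move=> hy; rewrite mulrDl mulrDr !(laurent_mono_tensM pP) !mulr1 !mul1r !hy.
by rewrite !add0r !addr0.
Qed.

Lemma tens_hh i m j m' : tens_h i m * tens_h j m' = tens_h j m' * tens_h i m.
Proof.
rewrite !mulrDl !mulrDr !(laurent_mono_tensM pP) !mulr1 !mul1r !add0r !addr0.
by rewrite (data_hh dataP i m) addrACA [m + m']addrC.
Qed.

Lemma int_delta_conj k1 k2 n : k1 * k2 = 1 ->
  k1 * int_delta U n * k2 = scal (1 : K) * int_delta U n.
Proof. by move=> kk; rewrite -int_delta_comm -mulrA kk mulr1 scal1 mul1r. Qed.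

Lemma tens_kx h1 s j r : tens_k h1 * tens_x s j r * tens_k (- h1) =
  scal (qp ((sgb s)%:~R * simple_root j h1)) * tens_x s j r.
Proof.
have kkN : k h1 * k (- h1) = 1 by rewrite (data_kk dataP) subrr (data_k0 dataP).
have kx n := data_kx dataP h1 s j n.
have kphi t n : k h1 * phi t j n * k (- h1) = scal 1 * phi t j n.
  by rewrite -(phi_data_k dataP) -mulrA kkN mulr1 scal1 mul1r.
set c := qp _; rewrite /tens_x mulrDr mulrDl [RHS]mulrDr; congr (_ + _).
  case: s @c kx => c kx.
    by rewrite (conv_conj pP (conv_x1 true j) (c := c) (d := 1)) ?mulr1 // => n;
       exact: int_delta_conj.
  by rewrite (conv_conj pP (conv_x1 false j) (c := 1) (d := c)) ?mul1r // => n;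
     exact: int_delta_conj.
case: s @c kx => c kx.
  by rewrite (conv_conj pP (conv_x2 true j) (c := 1) (d := c)) ?mul1r.
by rewrite (conv_conj pP (conv_x2 false j) (c := c) (d := 1)) ?mulr1.
Qed.

Lemma tens_hx i m s j r : tens_h i m * tens_x s j r - tens_x s j r * tens_h i m =
  scal ((sgb s)%:~R * m%:~R^-1 * quantum_int q (m * symB i j)) * tens_x s j (m + r).
Proof.
have hx n := data_hxE dataP i m s j n.
(* Series commuting with [h i m], namely phi and the constant series 1, are treated as having
   bracket scalar 0, so [conv_bracket] covers every summand. *)
have comm0 f : (forall n : int, f n * h i m = h i m * f n) ->
    forall n, h i m * f n - f n * h i m = scal (0 : K) * f (m + n).
  by move=> fh n; rewrite fh subrr scal0 mul0r.
have hphi t := comm0 _ (fun n => phi_data_h dataP t j n i m).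
have hdelta := comm0 _ (fun n => int_delta_comm n (h i m)).
set c := _ * _ * quantum_int _ _.
rewrite /tens_x [tens_h i m * _]mulrDr [_ * tens_h i m]mulrDl [RHS]mulrDr.
rewrite opprD addrACA.
congr (_ + _).
  case: s @c hx => c hx.
    by apply: etrans (conv_bracket pP (conv_x1 true j) _ hx hdelta) _; rewrite addr0.
  by apply: etrans (conv_bracket pP (conv_x1 false j) _ hdelta hx) _; rewrite add0r.
case: s @c hx => c hx.
  apply: etrans (conv_bracket pP (conv_x2 true j) _ (hphi false) hx) _.
  by rewrite add0r.
by apply: etrans (conv_bracket pP (conv_x2 false j) _ hx (hphi true)) _; rewrite addr0.
Qed.

(** In each of the eight cases one tensor slot holds commuting series (two series phi, or one of
    them the constant 1) while the other satisfies the quadratic relation. *)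
Lemma tens_quad s i j :
  quad_rel (q ^ (sgb s * symB i j)) (tens_x s i) (tens_x s j).
Proof.
have q1 := phi_quad q_neq0 q_sqr qp_int dataP.
have sBC : symB i j = symB j i :> int by exact: gcm_symP.
(* Symmetry of B allows the relation of phi with x to be used with [i] and [j] exchanged. *)
have q2 t : quad_rel (q ^ (sgb s * symB i j)) (x s i) (phi t j).
  by rewrite sBC; apply: quad_relC; exact: q1.
have qx := data_quad dataP s i j.
have dC := @int_delta_comm _ U.
have phiC := phi_dataC dataP.
apply: quad_relD; apply: quad_relDr; case: s q2 qx => q2 qx.
- exact: (conv_quad_l pP (conv_x1 true i) (conv_x1 true j)).
- exact: (conv_quad_r pP (conv_x1 false i) (conv_x1 false j)).
- exact: (conv_quad_l pP (conv_x1 true i) (conv_x2 true j)).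
- exact: (conv_quad_r pP (conv_x1 false i) (conv_x2 false j)).
- by apply: (conv_quad_l pP (conv_x2 true i) (conv_x1 true j)) => // *; rewrite -dC.
- by apply: (conv_quad_r pP (conv_x2 false i) (conv_x1 false j)) => // *; rewrite -dC.
- by apply: (conv_quad_r pP (conv_x2 true i) (conv_x2 true j)).
- by apply: (conv_quad_l pP (conv_x2 false i) (conv_x2 false j)).
Qed.

Lemma tens_xx i r j r' :
  tens_x true i r * tens_x false j r' - tens_x false j r' * tens_x true i r =
  if i == j then
    scal (q ^+ gcm_sym i - (q ^+ gcm_sym i)^-1)^-1 *
    (phi_data q tens_k tens_h true i (r + r') -
     phi_data q tens_k tens_h false i (r + r'))
  else 0.
Proof.
have sBC : symB i j = symB j i :> int by exact: gcm_symP.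
have q1 := phi_quad q_neq0 q_sqr qp_int dataP.
have dC := @int_delta_comm _ U.
rewrite comm_add; last 2 first.
- by apply: (conv_comm pP (conv_x1 true i) (conv_x1 false j)) => *; rewrite ?dC.
(* In the left slot phi^- of [i] meets x^- of [j] with parameter q^(-B_ij); in the right slot x^+ of
   [i] meets phi^+ of [j] with the inverse parameter. *)
- apply: (conv_quad_comm pP (conv_x2 true i) (conv_x2 false j)
     (q := q ^ (sgb false * symB i j))).
  + by rewrite expfz_neq0.
  + by move=> n; exact: phi_neg_gt0.
  + by move=> n; exact: phi_pos_lt0.
  + exact: q1.
  + by apply: quad_relC; rewrite invr_expz sBC -mulNr; exact: q1.
have xx n n' := data_xx dataP i n j n'.
set c := (_ - _)^-1 in xx *.
have X1 n :
   (tens_x1 true i r * tens_x2 false j r' -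
      tens_x2 false j r' * tens_x1 true i r) n =
   (x true i r * x false j (r' - n) - x false j (r' - n) * x true i r) ⊗ phi true j n.
  have -> : tens_x1 true i r = laurent_mono 0 (x true i r ⊗ 1) by [].
  rewrite laurent_coefB (laurent_coefM_mono (tens_x2 false j r')).
  rewrite laurent_mono_coefM subr0.
  rewrite (conv_x2 false j) !(tensM pP) mul1r mulr1.
  by rewrite (tensDl pP) (tensNl pP).
have X2 n :
   (tens_x2 true i r * tens_x1 false j r' -
      tens_x1 false j r' * tens_x2 true i r) n =
   phi false i (r - (n - r')) ⊗
     (x true i (n - r') * x false j r' - x false j r' * x true i (n - r')).
  have -> : tens_x1 false j r' = laurent_mono r' (1 ⊗ x false j r') by [].
  rewrite laurent_coefB laurent_coefM_mono laurent_mono_coefM.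
  rewrite (conv_x2 true i) !(tensM pP) mul1r mulr1.
  by rewrite (tensDr pP) (tensNr pP).
apply: laurentP => n; rewrite laurent_coefD X1 X2 !xx.
case: eqP => [<-|_]; last by rewrite (tens0l pP) (tens0r pP) addr0 laurent_coef0.
rewrite laurent_coefZ laurent_coefB !tens_phi_conv (tensZl pP) (tensZr pP) -mulrDr.
congr (_ * _).
have -> : r + (r' - n) = r + r' - n by lia.
have -> : r - (n - r') = r + r' - n by lia.
have -> : n - r' + r' = n by lia.
(* The mixed terms phi^- ⊗ phi^+ of the two brackets cancel. *)
rewrite (tensDl pP) (tensNl pP) (tensDr pP) (tensNr pP).
by rewrite addrA subrK.
Qed.

Lemma tens_data : affine_data q qp tens_x tens_k tens_h.
Proof.
split.
- by move=> h1 h2; rewrite /tens_k (laurent_mono_tensM pP) addr0 !(data_kk dataP).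
- by rewrite /tens_k (data_k0 dataP) (tens11 pP).
- move=> i; rewrite /tens_h (data_h0 dataP) (tens0l pP) (tens0r pP).
  exact: addr0.
- move=> h1 j m; apply/esym/tens_h_comm => j' l.
  by rewrite (data_kh dataP).
- exact: tens_hh.
- exact: tens_kx.
- by move=> i m s j r _; exact: tens_hx.
- exact: tens_xx.
- exact: tens_quad.
Qed.

End TensorData.

(** * The presentation of Uaff *)

(** Translates between the quadratic relation as written in [affine_rel] and the subtraction-free
    [quad_rel]. *)
Lemma quad_subE (K : pzRingType) (A : pzAlgType K) (c : K) (u v w t : A) :
  u - scal c * v = scal c * w - t <-> u + t = scal c * (w + v).
Proof.
rewrite mulrDr; split=> [e|e].
  by apply/eqP; rewrite -subr_eq addrAC e subrK.
by apply/eqP; rewrite subr_eq addrAC -e addrK.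
Qed.

Section AffineUniversal.
Variables (R : realType) (D : realized_gcm) (q lq : R[i]).
Local Notation I := 'I_(gcm_rank D).
Local Notation H := (cartan_space D).
Local Notation K := R[i].
Local Notation F := (free_alg K (affine_gen D)).

Lemma exp_coefE (a : nat -> F) m : exp_coef a m = expc a m.
Proof.
rewrite /exp_coef /expc; apply: eq_bigr => j _; congr (_ * _).
exact: poly_exp_coef.
Qed.

Section Morphism.
Variables (B : pzAlgType K) (f : F -> B).
Hypothesis fP : alg_morphism f.

Local Notation fx := (fun s i r => f (xF R s i r)).
Local Notation fk := (fun h1 => f (kF R h1)).
Local Notation fh := (fun i m => f (hF0 R i m)).

Lemma morph_phiF s i m : f (phiF q s i m) = phi_data q fk fh s i m.
Proof.
rewrite /phiF /phi_data; case: ifP => _; last exact: alg_morph0 fP.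
apply: alg_morphM_eq => //.
rewrite exp_coefE (expc_morph _ _ fP); apply: eq_expc => b.
exact: alg_morphZ fP _ _.
Qed.

Lemma hF0_hF i (m : {m : int | m != 0}) : hF0 R i (val m) = hF R i m :> F.
Proof. by rewrite /hF0 valK. Qed.

Lemma hF0_0 i : hF0 R i 0 = 0 :> F.
Proof. by rewrite /hF0 insubF. Qed.

(** Each relation is pushed through [f]. The index 0 of h is no generator: there [hF0] is 0 and the
    relations among k and h hold trivially. *)
Lemma affine_rel_data :
  (forall a b : F, affine_rel q lq a b -> f a = f b) ->
  affine_data q (qpow lq) fx fk fh.
Proof.
move=> fE; pose fM := alg_morphM_eq fP; pose fB := alg_morphB_eq fP.
pose fZ := alg_morphZ_eq fP; have f0 : f 0 = 0 := alg_morph0 fP.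
split.
- move=> h1 h2; apply: etrans (esym (fM _ _ _ _ erefl erefl)) _.
  exact/fE/rel_kk.
- by apply: etrans (alg_morph1 fP); exact/fE/rel_k0.
- by move=> i; rewrite hF0_0.
- move=> h1 j m; have [->|m0] := eqVneq m 0.
    by rewrite hF0_0 f0 mulr0 mul0r.
  rewrite -[m]/(val (Sub m m0 : {m : int | m != 0})) hF0_hF.
  apply: etrans (esym (fM _ _ _ _ erefl erefl)) _.
  apply: etrans (fM _ _ _ _ erefl erefl); exact/fE/rel_kh.
- move=> i m j m'; have [->|m0] := eqVneq m 0.
    by rewrite hF0_0 f0 mulr0 mul0r.
  have [->|m'0] := eqVneq m' 0.
    by rewrite hF0_0 f0 mulr0 mul0r.
  rewrite -[m]/(val (Sub m m0 : {m : int | m != 0})) hF0_hF.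
  rewrite -[m']/(val (Sub m' m'0 : {m : int | m != 0})) hF0_hF.
  apply: etrans (esym (fM _ _ _ _ erefl erefl)) _.
  apply: etrans (fM _ _ _ _ erefl erefl); exact/fE/rel_hh.
- move=> h1 s j r.
  apply: etrans (esym (fM _ _ _ _ (fM _ _ _ _ erefl erefl) erefl)) _.
  apply: etrans (fZ _ _ _ erefl); exact/fE/rel_kx.
- move=> i m s j r m0.
  rewrite -[m]/(val (Sub m m0 : {m : int | m != 0})) hF0_hF.
  apply: etrans (esym (fB _ _ _ _ (fM _ _ _ _ erefl erefl)
    (fM _ _ _ _ erefl erefl))) _.
  apply: etrans (fZ _ _ _ erefl); exact/fE/rel_hx.
- move=> i r j r'.
  apply: etrans (esym (fB _ _ _ _ (fM _ _ _ _ erefl erefl)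
    (fM _ _ _ _ erefl erefl))) _.
  apply: etrans (fE _ _ (rel_xx _ _ i r j r')) _; case: eqP => // _.
  exact: fZ _ _ _ (fB _ _ _ _ (morph_phiF _ _ _) (morph_phiF _ _ _)).
- move=> s i j r r'; apply/quad_subE.
  apply: etrans (esym (fB _ _ _ _ (fM _ _ _ _ erefl erefl)
    (fZ _ _ _ (fM _ _ _ _ erefl erefl)))) _.
  apply: etrans (fB _ _ _ _ (fZ _ _ _ (fM _ _ _ _ erefl erefl))
    (fM _ _ _ _ erefl erefl)).
  exact/fE/rel_quad.
Qed.

End Morphism.

Section Lift.
Variables (B : pzAlgType K) (x : bool -> I -> int -> B) (k : H -> B).
Variable h : I -> int -> B.
Hypothesis dataP : affine_data q (qpow lq) x k h.

Definition affine_value (g : affine_gen D) : B :=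
  match g with
  | GenX s i r => x s i r
  | GenK h1 => k h1
  | GenH i m => h i (val m)
  end.

Local Notation f := (free_lift affine_value).
Let fP : alg_morphism f := free_lift_morphism _.

Lemma affine_lift_x s i r : f (xF R s i r) = x s i r.
Proof. exact: free_lift_var. Qed.

Lemma affine_lift_k h1 : f (kF R h1) = k h1.
Proof. exact: free_lift_var. Qed.

Lemma affine_lift_hF i m : f (hF R i m) = h i (val m).
Proof. exact: free_lift_var. Qed.

Lemma affine_lift_h i m : f (hF0 R i m) = h i m.
Proof.
rewrite /hF0; case: insubP => [m' _ <-|]; first exact: affine_lift_hF.
by rewrite negbK => /eqP ->; rewrite (data_h0 dataP); exact: alg_morph0 fP.
Qed.

Lemma affine_lift_phi s i m : f (phiF q s i m) = phi_data q k h s i m.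
Proof.
rewrite (morph_phiF fP) /phi_data; case: ifP => // _.
rewrite affine_lift_k; congr (_ * _); apply: eq_expc => b.
by rewrite /phi_exponent affine_lift_h.
Qed.

Lemma affine_lift_rel a b : affine_rel q lq a b -> f a = f b.
Proof.
pose fM := alg_morphM_eq fP; pose fB := alg_morphB_eq fP.
pose fZ := alg_morphZ_eq fP.
pose fx := affine_lift_x; pose fk := affine_lift_k; pose fh := affine_lift_hF.
case=> [h1 h2||h1 j m|i m j m'|h1 s j r|i m s j r|i r j r'|s i r j r'].
- apply: etrans (fM _ _ _ _ (fk h1) (fk h2)) _.
  exact: etrans (data_kk dataP _ _) (esym (fk _)).
- by apply: etrans (fk 0) _; apply: etrans (data_k0 dataP) (esym (alg_morph1 fP)).
- apply: etrans (fM _ _ _ _ (fk h1) (fh j m)) _.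
  exact: etrans (data_kh dataP _ _ _) (esym (fM _ _ _ _ (fh j m) (fk h1))).
- apply: etrans (fM _ _ _ _ (fh i m) (fh j m')) _.
  exact: etrans (data_hh dataP _ _ _ _) (esym (fM _ _ _ _ (fh j m') (fh i m))).
- apply: etrans (fM _ _ _ _ (fM _ _ _ _ (fk _) (fx _ _ _)) (fk _)) _.
  exact: etrans (data_kx dataP _ _ _ _) (esym (fZ _ _ _ (fx s j r))).
- apply: etrans (fB _ _ _ _ (fM _ _ _ _ (fh _ _) (fx _ _ _))
    (fM _ _ _ _ (fx _ _ _) (fh _ _))) _.
  exact: etrans (data_hx dataP _ _ _ _ (valP m)) (esym (fZ _ _ _ (fx _ _ _))).
- apply: etrans (fB _ _ _ _ (fM _ _ _ _ (fx _ _ _) (fx _ _ _))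
    (fM _ _ _ _ (fx _ _ _) (fx _ _ _))) _.
  apply: etrans (data_xx dataP _ _ _ _) _.
  case: eqP => _; last exact/esym/(alg_morph0 fP).
  exact/esym/(fZ _ _ _ (fB _ _ _ _ (affine_lift_phi _ _ _) (affine_lift_phi _ _ _))).
- apply: etrans (fB _ _ _ _ (fM _ _ _ _ (fx _ _ _) (fx _ _ _))
    (fZ _ _ _ (fM _ _ _ _ (fx _ _ _) (fx _ _ _)))) _.
  apply: etrans (esym (fB _ _ _ _ (fZ _ _ _ (fM _ _ _ _ (fx _ _ _) (fx _ _ _)))
    (fM _ _ _ _ (fx _ _ _) (fx _ _ _)))).
  exact/quad_subE/(data_quad dataP).
Qed.

End Lift.

End AffineUniversal.

(** * Existence and uniqueness of the coproduct *)

Section BaseChangeLift.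
Variables (K : comNzRingType) (A : pzAlgType K).
Local Notation T := (laurent (tens A A)).
Local Notation CC := (laurent_field K).

Lemma tens_tensor_map : tensor_map (@pure_tens K A A).
Proof.
split; [exact: pure_tens1|exact: pure_tensM|exact: pure_tensDl
  |exact: pure_tensDr|exact: pure_tensZl|exact: pure_tensZr].
Qed.

(** Compatibility of the two algebra structures on (A ⊗ A)((u)), which permits passing between
    morphisms over K and over K((u)). *)
Lemma completed_tens_scalE (c : K) :
  completed_tens_scal A (laurent_field_scal c) = scal c :> T.
Proof.
apply: laurentP => n; rewrite /completed_tens_scal /=.
by case: ifP => // _; exact: scal0.
Qed.

Lemma completed_tens_scal_morphism :
  alg_morphism (completed_tens_scal A : CC -> T).
Proof.
split; [exact: completed_tens_scalD|exact: completed_tens_scalM|].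
exact: completed_tens_scalE.
Qed.

(** Universal property of the tensor product, applied to the scalars of K((u)) and to [f]; their
    images commute because scalars are central. *)
Lemma base_change_lift (f : A -> T) : alg_morphism f ->
  exists2 Delta : base_change A -> completed_tens A,
    alg_morphism (K := CC) Delta & forall a, Delta (base_emb a) = f a.
Proof.
move=> fP; pose sP := completed_tens_scal_morphism.
have sfC g a : completed_tens_scal A g * f a = f a * completed_tens_scal A g.
  exact: completed_tens_scalC.
have [DD DM Dc] := tens_lift_morphism sP fP sfC.
exists (tens_lift (completed_tens_scal A : CC -> T) f); last first.
  move=> a; apply: etrans (tens_lift_pure sP fP sfC 1 a) _.
  by rewrite (alg_morph1 sP) mul1r.
split=> // g; apply: etrans (tens_lift_pure sP fP sfC g 1) _.
by rewrite (alg_morph1 fP) mulr1.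
Qed.

Lemma base_emb_scal (c : K) : base_emb (scal c : A) = scal (laurent_field_scal c : CC).
Proof.
apply: etrans (congr1 _ (esym (mulr1 (scal c)))) _.
apply: etrans (pure_tensZr c 1 1) _.
by apply: etrans (esym (pure_tensZl c 1 1)) _; rewrite mulr1.
Qed.

Lemma base_emb_comp_morphism (Delta : base_change A -> completed_tens A) :
  alg_morphism (K := CC) Delta ->
  alg_morphism (fun a => Delta (base_emb a) : T).
Proof.
move=> [DD DM Dc]; split=> [a b|a b|c].
- by apply: etrans (DD _ _); congr Delta; exact: pure_tensDr.
- apply: etrans (DM _ _); congr Delta; apply/esym.
  by apply: etrans (pure_tensM _ _ _ _) _; rewrite mulr1.
- by rewrite base_emb_scal Dc; exact: completed_tens_scalE.
Qed.

Lemma base_change_ext (D1 D2 : base_change A -> completed_tens A) :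
  alg_morphism (K := CC) D1 -> alg_morphism (K := CC) D2 ->
  (forall a, D1 (base_emb a) = D2 (base_emb a)) -> D1 =1 D2.
Proof.
move=> [D1D D1M D1c] [D2D D2M D2c] D12; apply: tens_ind => [g a|x y Dx Dy].
  (* A pure tensor is a K((u))-scalar times an element of A. *)
  have -> : g ⊗ a = scal (g : CC) * base_emb a :> base_change A.
    by apply/esym; apply: etrans (pure_tensM _ _ _ _) _; rewrite mulr1 mul1r.
  apply: etrans (D1M _ _) (etrans _ (esym (D2M _ _))).
  by rewrite D12 D1c D2c.
by apply: etrans (D1D _ _) (etrans _ (esym (D2D _ _))); rewrite Dx Dy.
Qed.

End BaseChangeLift.

(** * Recovering h from phi *)

Section CartanUnique.
Variables (K : numFieldType) (D : realized_gcm) (q : K) (qp : rat -> K).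
Hypothesis q_sqr : q - q^-1 != 0.

(* phi determines the h_{i, m}, as a series determines its logarithm *)
Lemma affine_data_h_unique (U : pzAlgType K) x k h x' k' h' :
  @affine_data K D q qp U x k h -> @affine_data K D q qp U x' k' h' -> k =1 k' ->
  (forall s i (m : nat), phi_data q k h s i (sgb s * m%:Z) =
                         phi_data q k' h' s i (sgb s * m%:Z)) ->
  forall i m, h i m = h' i m.
Proof.
move=> dP d'P kk phiphi i m.
have [->|m0] := eqVneq m 0; first by rewrite (data_h0 dP) (data_h0 d'P).
(* The sign of [m] selects the series, phi^+ or phi^-, whose logarithm contains [h i m]. *)
pose s := 0 < m; have mE : m = sgb s * (absz m).-1.+1%:Z.
  by rewrite /s; case: ltP => //=; lia.
move: (absz m).-1 mE => b ->.
have EE n : expc (phi_exponent q h s i) n = expc (phi_exponent q h' s i) n.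
  have := phiphi s i n; rewrite /phi_data sgbK /= -kk.
  have -> : absz (sgb s * n%:Z) = n by rewrite abszM; case: (s); rewrite mul1n.
  move/(congr1 ( *%R (k (- cartan_shift s i)))).
  by rewrite !mulrA (kN_mul dP) !mul1r.
have rec : exp_rec (phi_exponent q h s i) (expc (phi_exponent q h s i)).
  by apply: expc_rec => *; exact: (phi_exponentC dP).
(* Both exponents now generate the same exponential series, so [exp_rec_inj] identifies them. *)
have rec' : exp_rec (phi_exponent q h' s i) (expc (phi_exponent q h s i)).
  rewrite (funext EE).
  by apply: expc_rec => *; exact: (phi_exponentC d'P).
have := exp_rec_inj b rec rec'; rewrite /phi_exponent => /eqP.
rewrite -subr_eq0 -mulrBr => /eqP /scal_mulr_eq0 h0.
apply: subr0_eq; apply: h0; rewrite mulf_neq0 //.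
by case: (s); rewrite ?oner_neq0 // rmorphN1 oppr_eq0 oner_neq0.
Qed.

End CartanUnique.

Section UaffUniversal.
Variables (R : realType) (D : realized_gcm) (q lq : R[i]).
Local Notation I := 'I_(gcm_rank D).
Local Notation H := (cartan_space D).
Local Notation K := R[i].
Local Notation U := (Uaff D q lq).
Local Notation rel := (@affine_rel R D q lq).
Local Notation pi := (alg_pi rel).

Definition h_ (i : I) (m : int) : U := pi (hF0 R i m).

Let piP : alg_morphism pi := alg_pi_morphism rel.

Let piE a b : rel a b -> pi a = pi b.
Proof. by move=> ab; exact/alg_piP/alg_cong_rel. Qed.

Lemma phi_E s i m : phi_ q lq s i m = phi_data q (@k_ R D q lq) h_ s i m.
Proof. exact: morph_phiF piP s i m. Qed.

Lemma Uaff_data : affine_data q (qpow lq) (@x_ R D q lq) (@k_ R D q lq) h_.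
Proof. exact: affine_rel_data piP piE. Qed.

Lemma Uaff_lift (B : pzAlgType K) x k h :
  @affine_data K D q (qpow lq) B x k h ->
  exists2 f : U -> B, alg_morphism f &
    [/\ forall s i r, f (x_ q lq s i r) = x s i r,
        forall h1, f (k_ q lq h1) = k h1 &
        forall s i m, f (phi_ q lq s i m) = phi_data q k h s i m].
Proof.
move=> dP; pose v := affine_value x k h.
have vP : alg_morphism (free_lift v) := free_lift_morphism v.
have vE : forall a b, rel a b -> free_lift v a = free_lift v b.
  exact: affine_lift_rel dP.
exists (quot_lift (free_lift v)); first exact: quot_lift_morphism vP vE.
split=> [s i r|h1|s i m].
- exact: etrans (quot_lift_pi vP vE (xF R s i r)) (affine_lift_x _ _ _ _ _ _).
- exact: etrans (quot_lift_pi vP vE (kF R h1)) (affine_lift_k _ _ _ _).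
- exact: etrans (quot_lift_pi vP vE (phiF q s i m)) (affine_lift_phi dP s i m).
Qed.

Hypothesis q_sqr : q - q^-1 != 0.

(** The generators h are absent from the hypotheses; they are recovered from k and phi by
    [affine_data_h_unique], applied to [f \o pi] and [g \o pi]. *)
Lemma Uaff_ext (B : pzAlgType K) (f g : U -> B) :
  alg_morphism f -> alg_morphism g ->
  (forall s i r, f (x_ q lq s i r) = g (x_ q lq s i r)) ->
  (forall h1, f (k_ q lq h1) = g (k_ q lq h1)) ->
  (forall s i (m : nat), f (phi_ q lq s i (sgb s * m%:Z)) =
                         g (phi_ q lq s i (sgb s * m%:Z))) -> f =1 g.
Proof.
move=> fP gP fgx fgk fgphi.
have fpiP := alg_morph_comp piP fP; have gpiP := alg_morph_comp piP gP.
have fE a b : rel a b -> (f \o pi) a = (f \o pi) b by move=> ab /=; rewrite (piE ab).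
have gE a b : rel a b -> (g \o pi) a = (g \o pi) b by move=> ab /=; rewrite (piE ab).
have fgh : forall i m, (f \o pi) (hF0 R i m) = (g \o pi) (hF0 R i m).
  apply: (affine_data_h_unique q_sqr (affine_rel_data fpiP fE)
    (affine_rel_data gpiP gE)).
    exact: fgk.
  move=> s i m; have e1 := morph_phiF q fpiP s i (sgb s * m%:Z).
  have e2 := morph_phiF q gpiP s i (sgb s * m%:Z).
  exact: etrans (esym e1) (etrans (fgphi s i m) e2).
have fg : f \o pi =1 g \o pi.
  apply: free_morph_eq => // -[s i r|h1|i m].
  - exact: fgx.
  - exact: fgk.
  - by have := fgh i (val m); rewrite hF0_hF.
by apply: alg_quotW => a; exact: fg.
Qed.

End UaffUniversal.

Section Coproduct.
Variables (K : numFieldType) (D : realized_gcm) (q : K) (qp : rat -> K).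
Local Notation I := 'I_(gcm_rank D).
Local Notation H := (cartan_space D).
Hypothesis q_neq0 : q != 0.
Hypothesis q_sqr : q - q^-1 != 0.
Hypothesis qp_int : forall z : int, qp z%:~R = q ^ z.

Variables (A : pzAlgType K) (x phi : bool -> I -> int -> A) (k : H -> A).
Variable h : I -> int -> A.
Hypothesis dataP : affine_data q qp x k h.
Hypothesis phiE : phi = phi_data q k h.

Hypothesis lift : forall (B : pzAlgType K) x' k' h', affine_data q qp x' k' h' ->
  exists2 f : A -> B, alg_morphism f &
    [/\ forall s i r, f (x s i r) = x' s i r, forall h1, f (k h1) = k' h1 &
        forall s i m, f (phi s i m) = phi_data q k' h' s i m].

Hypothesis ext : forall (B : pzAlgType K) (f g : A -> B),
  alg_morphism f -> alg_morphism g ->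
  (forall s i r, f (x s i r) = g (x s i r)) ->
  (forall h1, f (k h1) = g (k h1)) ->
  (forall s i (m : nat), f (phi s i (sgb s * m%:Z)) = g (phi s i (sgb s * m%:Z))) ->
  f =1 g.

(** Only the relations in A and the two halves [lift] and [ext] of its universal property enter:
    [tens_data] feeds [lift], and the result is extended to K((u)). *)
Lemma coproduct_exists_unique :
  exists! Delta : base_change A -> completed_tens A,
    [/\ alg_morphism (K := laurent_field K) Delta,
        forall i r, Delta (base_emb (x true i r)) =
          umono 0 (x true i r ⊗ 1) +
          useries r (fun l => phi false i (- l%:Z) ⊗ x true i (r + l%:Z)),
        forall i r, Delta (base_emb (x false i r)) =
          umono r (1 ⊗ x false i r) +
          useries 0 (fun l => x false i (r - l%:Z) ⊗ phi true i l%:Z),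
        forall s i (m : nat), Delta (base_emb (phi s i (sgb s * m%:Z))) =
          \sum_(l < m.+1) umono (sgb s * l%:Z)
             (phi s i (sgb s * (m%:Z - l%:Z)) ⊗ phi s i (sgb s * l%:Z)) &
        forall h1, Delta (base_emb (k h1)) = umono 0 (k h1 ⊗ k h1)].
Proof.
have tP := tens_tensor_map A.
have [f fP [fx fk fphi]] := lift (tens_data q_neq0 q_sqr qp_int tP dataP).
have [Delta DP DE] := base_change_lift fP.
have Dxp i r : Delta (base_emb (x true i r)) =
    umono 0 (x true i r ⊗ 1) +
    useries r (fun l => phi false i (- l%:Z) ⊗ x true i (r + l%:Z)).
  by rewrite phiE; exact: etrans (DE _) (fx _ _ _).
have Dxm i r : Delta (base_emb (x false i r)) =
    umono r (1 ⊗ x false i r) +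
    useries 0 (fun l => x false i (r - l%:Z) ⊗ phi true i l%:Z).
  by rewrite phiE; exact: etrans (DE _) (fx _ _ _).
have Dphi s i (m : nat) : Delta (base_emb (phi s i (sgb s * m%:Z))) =
    \sum_(l < m.+1) umono (sgb s * l%:Z)
      (phi s i (sgb s * (m%:Z - l%:Z)) ⊗ phi s i (sgb s * l%:Z)).
  apply: etrans (DE _) (etrans (fphi _ _ _) _); rewrite phiE.
  exact: (tens_phi_sum tP dataP).
have Dk h1 : Delta (base_emb (k h1)) = umono 0 (k h1 ⊗ k h1).
  exact: etrans (DE _) (fk _).
exists Delta; split=> // Delta' [D'P D'xp D'xm D'phi D'k]; apply: funext.
apply: base_change_ext => //.
(* Uniqueness: two K((u))-morphisms are compared on A, where the prescribed values on x, k and phi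
   suffice. *)
apply: (ext (base_emb_comp_morphism DP) (base_emb_comp_morphism D'P)).
- by case=> i r; [exact: etrans (Dxp i r) (esym (D'xp i r))
                 | exact: etrans (Dxm i r) (esym (D'xm i r))].
- by move=> h1; exact: etrans (Dk h1) (esym (D'k h1)).
- by move=> s i m; exact: etrans (Dphi s i m) (esym (D'phi s i m)).
Qed.

End Coproduct.

(** * The complex exponential and integral powers of q *)

Section ComplexExponential.
Variable R : realType.
Implicit Types z w : R[i].

Lemma cexpD z w : cexp (z + w) = cexp z * cexp w.
Proof.
case: z => a b; case: w => c d; rewrite /cexp /= expRD cosD sinD.
by apply/eqP; rewrite eq_complex /=; apply/andP; split; apply/eqP; ring.
Qed.

Lemma cexp0 : cexp (0 : R[i]) = 1.
Proof. by rewrite /cexp /= expR0 cos0 sin0 mulr1 mulr0. Qed.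

Lemma cexp_neq0 z : cexp z != 0.
Proof.
apply/eqP => z0; have := cexpD z (- z).
by rewrite subrr cexp0 z0 mul0r => /eqP; rewrite oner_eq0.
Qed.

Lemma cexpMz (z : int) w : cexp (z%:~R * w) = cexp w ^ z.
Proof.
have cexpMn n : cexp (n%:R * w) = cexp w ^+ n.
  elim: n => [|n IHn]; first by rewrite mul0r cexp0.
  by rewrite mulrS mulrDl mul1r cexpD IHn exprS.
case: z => n; first by rewrite -pmulrn cexpMn.
rewrite NegzE rmorphN /= -pmulrn mulNr.
apply: (mulfI (cexp_neq0 (n.+1%:R * w))).
by rewrite -cexpD subrr cexp0 cexpMn exprnP -expfzDr ?cexp_neq0 // subrr.
Qed.

(** The Cartan part of phi acts on x through an integral exponent plus or minus B_ij, so powers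
    defined by the logarithm must agree there with ordinary ones. *)
Lemma qpow_int (lq : R[i]) (z : int) : qpow lq z%:~R = cexp lq ^ z.
Proof. by rewrite /qpow ratr_int cexpMz. Qed.

End ComplexExponential.

Unset Implicit Arguments.

Theorem proposition6p3 (R : realType) (D : realized_gcm) (q lq : R[i])
    (log_q : cexp lq = q)
    (q_not_root1 : forall m : nat, (0 < m)%N -> q ^+ m <> 1) :
  exists! Delta : base_change (Uaff D q lq) -> completed_tens (Uaff D q lq),
    [/\ alg_morphism (K := laurent_field R[i]) Delta,
        forall i r,
          Delta (base_emb (x_ q lq true i r)) =
            umono 0 (x_ q lq true i r ⊗ 1) +
            useries r (fun l => phi_ q lq false i (- l%:Z)
                                ⊗ x_ q lq true i (r + l%:Z)),
        forall i r,
          Delta (base_emb (x_ q lq false i r)) =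
            umono r (1 ⊗ x_ q lq false i r) +
            useries 0 (fun l => x_ q lq false i (r - l%:Z)
                                ⊗ phi_ q lq true i l%:Z),
        forall s i (m : nat),
          Delta (base_emb (phi_ q lq s i (sgb s * m%:Z))) =
            \sum_(l < m.+1)
              umono (sgb s * l%:Z)
                (phi_ q lq s i (sgb s * (m%:Z - l%:Z))
                 ⊗ phi_ q lq s i (sgb s * l%:Z)) &
        forall h,
          Delta (base_emb (k_ q lq h)) = umono 0 (k_ q lq h ⊗ k_ q lq h)].
Proof.
have q_neq0 : q != 0 by rewrite -log_q cexp_neq0.
have q_sqr : q - q^-1 != 0.
  (* If q were equal to q^-1, then q^2 = 1, against the assumption on roots of unity. *)
  apply/eqP => /subr0_eq qV; apply: (q_not_root1 2%N) => //.
  by rewrite expr2 {2}qV divff.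
have qp_int z : qpow lq z%:~R = q ^ z by rewrite qpow_int log_q.
have phi_fun : phi_ q lq = phi_data q (@k_ R D q lq) (h_ q lq).
  by apply: funext => s; apply: funext => i; apply: funext => m; exact: phi_E.
exact: (coproduct_exists_unique q_neq0 q_sqr qp_int (Uaff_data D q lq) phi_fun
  (@Uaff_lift R D q lq) (@Uaff_ext R D q lq q_sqr)).
Qed.
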